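(* Let $\mathbb{K}$ be a field, $n,d\ge1$ and $k\ge0$ integers with $k\ne0$. Then the first step of the minimal graded free resolution of $S_{n,d,k}$ over $R$ is pseudo-linear, i.e. $\beta_0(S_{n,d,k})=\beta_{0,k}(S_{n,d,k})$ and $\beta_1(S_{n,d,k})=\beta_{1,k+d}(S_{n,d,k})$; and the Betti numbers $\beta_{0,k},\beta_{1,k+d},\beta_{2,k+2d}$ of $S_{n,d,k}$ are determined by its Hilbert series: for $i=0,1,2$, $\beta_{i,k+id}(S_{n,d,k})$ equals $(-1)^i$ times the coefficient of $z^{k+id}$ in $P(z)=(1-z^d)^N\,HS(S_{n,d,k};z)$.
   Context: $S=\mathbb{K}[x_1,\dots,x_n]=\bigoplus_{j\ge0}S_j$ with the standard grading, and $S_{n,d,k}=\bigoplus_{i\ge0}S_{k+id}$. $\mathcal{A}=\{\mathbf{a}\in\mathbb{N}^n:\sum_i a_i=d\}=\{\mathbf{a}_1,\dots,\mathbf{a}_N\}$ with $N=\binom{d+n-1}{d}$. $R=\mathbb{K}[y_1,\dots,y_N]$, with $\deg y_i=d$, acts on $S_{n,d,k}$ via $y_i\mapsto\mathbf{x}^{\mathbf{a}_i}$; elements of $S_{k+id}$ have degree $k+id$. $\beta_{i,j}(M)=\dim_{\mathbb{K}}\operatorname{Tor}_i^R(M,\mathbb{K})_j$ and $\beta_i(M)=\sum_j\beta_{i,j}(M)$. $HS(M;z)=\sum_j\dim_{\mathbb{K}}(M_j)z^j$ is the Hilbert series; one has $P(z)=\sum_{i,j}(-1)^i\beta_{i,j}(S_{n,d,k})z^j$.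 *)

(* Defs.v *)
From HB Require Import structures.
From mathcomp Require Import all_boot all_order all_algebra.
From mathcomp Require Import boolp classical_sets cardinality fsbigop.
From mathcomp Require Import mpoly.
Set Implicit Arguments.
Unset Strict Implicit.
Unset Printing Implicit Defensive.
Import GRing.Theory.
Local Open Scope ring_scope.

(* R = K[y_1, ..., y_N] is graded by deg y_i = d.  Zero is homogeneous of
   every degree. *)
Definition homogR (K : fieldType) (N d e : nat) (p : {mpoly K[N]}) : Prop :=
  forall m, m \in msupp p -> (d * mdeg m)%N = e.

(* N-graded modules over R: gcomp j is the component of degree j, and the last
   two axioms express that the module is the direct sum of its components. *)
Record gradedModule (K : fieldType) (N d : nat) := GradedModule {
  gsort :> lmodType {mpoly K[N]};
  gcomp : nat -> set gsort;
  gcomp0 : forall j, gcomp j 0;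
  gcompD : forall j u v, gcomp j u -> gcomp j v -> gcomp j (u + v);
  gcompZ : forall e j p v,
    homogR d e p -> gcomp j v -> gcomp (e + j)%N (p *: v);
  gcomp_span : forall v, exists b (s : 'I_b -> gsort),
    (forall j : 'I_b, gcomp j (s j)) /\ v = \sum_(j < b) s j;
  gcomp_direct : forall b (s : 'I_b -> gsort),
    (forall j : 'I_b, gcomp j (s j)) -> \sum_(j < b) s j = 0 ->
    forall j, s j = 0
}.

Section GradedModuleInvariants.
Variables (K : fieldType) (N d : nat) (M : gradedModule K N d).

(* b is the dimension over K (acting through the constants of R) of the
   component of degree j: that component has a basis of size b. *)
Definition has_dim (j b : nat) : Prop :=
  exists2 e : 'I_b -> M, (forall a, gcomp j (e a)) &
    forall v : M, gcomp j v ->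
      exists! c : 'rV[K]_b, v = \sum_a (c 0 a)%:MP *: e a.

(* The coefficients of the Hilbert series HS(M; z). *)
Definition hilbert (j : nat) : nat := xget 0%N [set b | has_dim j b].

(* Graded free resolutions by free modules of finite rank (these exist for
   every finitely generated M).  The i-th module is R^(rk i), whose a-th basis
   vector has degree gdeg i a; its elements are row vectors, on which the
   matrix diff i : R^(rk (i+1)) -> R^(rk i) acts by right multiplication.
   The augmentation R^(rk 0) -> M sends the a-th basis vector to aug a. *)
Record gradedFreeResolution := GradedFreeResolution {
  rk : nat -> nat;
  gdeg : forall i, 'I_(rk i) -> nat;
  diff : forall i, 'M[{mpoly K[N]}]_(rk i.+1, rk i);
  aug : 'I_(rk 0) -> M;
  diff_homog : forall i a b m, m \in msupp (diff i a b) ->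
    (d * mdeg m + gdeg b)%N = gdeg a;
  aug_homog : forall a, gcomp (gdeg a) (aug a);
  aug_surj : forall v : M, exists w : 'rV_(rk 0), v = \sum_a w 0 a *: aug a;
  aug_exact : forall w : 'rV_(rk 0),
    \sum_a w 0 a *: aug a = 0 <-> exists u, w = u *m diff 0;
  diff_exact : forall i (w : 'rV_(rk i.+1)),
    w *m diff i = 0 <-> exists u, w = u *m diff i.+1
}.

Section Tor.
Variable F : gradedFreeResolution.

(* The complex F (x)_R K, where K = R / (y_1, ..., y_N): its i-th term is
   K^(rk F i), and its differentials are the matrices of constant terms. *)
Definition tor_diff i : 'M[K]_(rk F i.+1, rk F i) :=
  map_mx (mcoeff 0%MM) (diff F i).

Definition tor_cycles i : 'M[K]_(rk F i) :=
  if i is i'.+1 then kermx (tor_diff i') else 1%:M.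

(* The row space is the component of degree j of the i-th term. *)
Definition tor_part i j : 'M[K]_(rk F i) :=
  diag_mx (\row_a (gdeg a == j)%:R).

(* dim_K of the component of degree j of H_i(F (x)_R K). *)
Definition tor_dim i j : nat :=
  (\rank (tor_cycles i :&: tor_part i j)%MS
   - \rank (tor_diff i :&: tor_part i j)%MS)%N.

End Tor.

(* beta_{i,j}(M) = dim_K Tor_i^R(M, K)_j, where Tor is computed from any graded
   free resolution of M (the dimension does not depend on the choice). *)
Definition betti (i j : nat) : nat :=
  xget 0%N [set b | exists F : gradedFreeResolution, b = tor_dim F i j].

(* A sum over all j in nat with only finitely many nonzero terms (the
   generators of a finite-rank F_i have finitely many degrees). *)
Definition total_betti (i : nat) : nat :=
  (\sum_(j \in [set: nat]) betti i j)%N.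

End GradedModuleInvariants.

(* The coefficient of z^m in the product of the polynomial p with the power
   series \sum_j (h j) z^j. *)
Definition coef_mul_series (p : {poly int}) (h : nat -> nat) (m : nat) : int :=
  \sum_(l < m.+1) p`_l * (h (m - l)%N)%:Z.

(* K[x_1, ..., x_n], to be made a module over R (which depends on d). *)
Definition polyS (K : fieldType) (n d : nat) : Type := {mpoly K[n]}.

Section Veronese.
Variables (K : fieldType) (n d k : nat).

Definition expA : {set 'X_{1..n < d.+1}} :=
  [set m : 'X_{1..n < d.+1} | mdeg m == d]%SET.

Definition expN : nat := #|expA|.

Definition exp_a (i : 'I_expN) : 'X_{1..n} := bmnm (enum_val i).

Lemma mdeg_exp_a i : mdeg (exp_a i) = d.
Proof. by have := enum_valP i; rewrite inE => /eqP. Qed.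

Lemma exp_aP (m : 'X_{1..n}) : mdeg m = d <-> exists i, m = exp_a i.
Proof.
split=> [md|[i ->]]; last exact: mdeg_exp_a.
have lt_m : (mdeg m < d.+1)%N by rewrite md.
have Am : BMultinom lt_m \in expA by rewrite inE /= md.
by exists (enum_rank_in Am (BMultinom lt_m)); rewrite /exp_a enum_rankK_in.
Qed.

Lemma exp_a_inj : injective exp_a.
Proof. by move=> i j /val_inj /enum_val_inj. Qed.

Definition yimg : expN.-tuple {mpoly K[n]} := [tuple 'X_[exp_a i] | i < expN].

(* S is an R-module through y_i |-> x^(a_i). *)
Local Notation verS := (polyS K n d).
HB.instance Definition _ := GRing.Zmodule.on verS.

Definition scaleS (p : {mpoly K[expN]}) (s : verS) : verS :=
  (p \mPo yimg) * (s : {mpoly K[n]}).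

Fact scaleSA p q s : scaleS p (scaleS q s) = scaleS (p * q) s.
Proof. by rewrite /scaleS rmorphM mulrA. Qed.
Fact scale1S : left_id 1 scaleS.
Proof. by move=> s; rewrite /scaleS rmorph1 mul1r. Qed.
Fact scaleSDr : right_distributive scaleS +%R.
Proof. by move=> p s t; rewrite /scaleS mulrDr. Qed.
Fact scaleSDl s : {morph scaleS^~ s : p q / p + q}.
Proof. by move=> p q; rewrite /scaleS rmorphD mulrDl. Qed.

HB.instance Definition _ := GRing.Zmodule_isLmodule.Build
  {mpoly K[expN]} verS scaleSA scale1S scaleSDr scaleSDl.

Lemma homog_yimg e (p : {mpoly K[expN]}) :
  homogR d e p -> p \mPo yimg \is e.-homog.
Proof.
move=> hp; rewrite comp_mpolyEX big_seq rpred_sum // => m /hp <-.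
apply: rpredZ; rewrite comp_mpolyX.
under eq_bigr do rewrite tnth_mktuple.
rewrite mprodXnE dhomogX /= mdeg_sum [mdeg m]mdegE big_distrr /=.
by apply/eqP; apply: eq_bigr => i _; rewrite mdegMn mdeg_exp_a.
Qed.

Lemma dvd_yimg (p : {mpoly K[expN]}) m :
  m \in msupp (p \mPo yimg) -> (d %| mdeg m)%N.
Proof.
rewrite comp_mpolyEX => /msupp_sum_le/flatten_mapP[m' _] /msuppZ_le.
have /homog_yimg/dhomogP h : homogR d (d * mdeg m') ('X_[K, m'] : {mpoly K[expN]}).
  by move=> m1 /mem_msuppXP <-.
by move=> /h ->; rewrite dvdn_mulr.
Qed.

(* The degrees of the monomials of s are all of the form k + i * d. *)
Definition in_veronese (s : verS) : bool :=
  all [pred m : 'X_{1..n} | (k <= mdeg m)%N && (d %| mdeg m - k)%N]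
      (msupp (s : {mpoly K[n]})).

Fact in_veronese_submod : submod_closed in_veronese.
Proof.
split=> [|p s t]; first by rewrite unfold_in /in_veronese msupp0.
move=> /allP hs /allP ht; apply/allP => m /msuppD_le; rewrite mem_cat.
case/orP=> [/msuppM_le/allpairsP[[m1 m2] /= [/dvd_yimg dm1 /hs /andP[km2 dm2] ->]]|/ht//].
rewrite /= mdegD (leq_trans km2) ?leq_addl //= -addnBA // dvdn_add //.
Qed.

HB.instance Definition _ := GRing.isSubmodClosed.Build
  {mpoly K[expN]} verS in_veronese in_veronese_submod.

Record veroneseS := VeroneseS {
  vero_val :> verS;
  _ : in_veronese vero_val
}.

HB.instance Definition _ := [isSub for vero_val].
HB.instance Definition _ := [Choice of veroneseS by <:].
HB.instance Definition _ := [SubChoice_isSubLmodule of veroneseS by <:].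

Definition vero_comp (j : nat) : set veroneseS :=
  [set s | (vero_val s : {mpoly K[n]}) \is j.-homog].

Fact vero_comp0 j : vero_comp j 0.
Proof. exact: dhomog0. Qed.

Fact vero_compD j u v :
  vero_comp j u -> vero_comp j v -> vero_comp j (u + v).
Proof. exact: rpredD. Qed.

Fact vero_compZ e j (p : {mpoly K[expN]}) v :
  homogR d e p -> vero_comp j v -> vero_comp (e + j)%N (p *: v).
Proof. by move=> /homog_yimg hp hv; apply: dhomogM. Qed.

Fact vero_val_sum b (s : 'I_b -> veroneseS) :
  (vero_val (\sum_(j < b) s j) : {mpoly K[n]}) =
  \sum_(j < b) (vero_val (s j) : {mpoly K[n]}).
Proof. by apply: (big_morph (fun s => vero_val s : {mpoly K[n]})). Qed.

Fact vero_comp_span v : exists b (s : 'I_b -> veroneseS),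
  (forall j : 'I_b, vero_comp j (s j)) /\ v = \sum_(j < b) s j.
Proof.
have pi_in j : in_veronese (pihomog mdeg j (vero_val v : {mpoly K[n]})).
  apply/allP => m /msupp_sum_le/flatten_mapP[m' + /msuppZ_le/mem_msuppXP <-].
  by rewrite mem_filter => /andP[_]; case: v => /= s /allP; apply.
exists (msize (vero_val v : {mpoly K[n]})), (fun j => VeroneseS (pi_in j)).
split=> [j|]; first exact: pihomogP.
apply/val_inj; rewrite /= vero_val_sum /=.
exact: pihomog_partitionE.
Qed.

Fact vero_comp_direct b (s : 'I_b -> veroneseS) :
  (forall j : 'I_b, vero_comp j (s j)) -> \sum_(j < b) s j = 0 ->
  forall j, s j = 0.
Proof.
move=> hs /(congr1 (fun s => pihomog mdeg _ (vero_val s : {mpoly K[n]}))) + j.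
move/(_ j); rewrite vero_val_sum linear_sum /= (bigD1 j) //= big1 => [|i ij].
  rewrite addr0 pihomog_dE ?linear0; last exact: hs.
  by move=> h; apply/val_inj.
by apply: (pihomog_ne0 (d := i)) => //; exact: hs.
Qed.

(* The graded R-module S_{n,d,k}. *)
Definition veronese : gradedModule K expN d :=
  GradedModule vero_comp0 vero_compD vero_compZ vero_comp_span vero_comp_direct.

(* P(z) = (1 - z^d)^N HS(S_{n,d,k}; z) *)
Definition coefP (m : nat) : int :=
  coef_mul_series ((1 - 'X^d) ^+ expN) (hilbert veronese) m.

End Veronese.

Lemma expN_bin n d : (0 < n)%N -> expN n d = 'C(d + n - 1, d).
Proof.
case: n => // n' _; rewrite addnS subn1 /= -size_basis.
pose f (m : 'X_{1..n'.+1 < d.+1}) : 'X_{1..n'.+1} := m.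
rewrite /expN cardE -(size_map f); apply/perm_size/uniq_perm.
- by rewrite map_inj_uniq ?enum_uniq //; apply: val_inj.
- exact: uniq_basis.
move=> m; rewrite -basis_cover; apply/mapP/eqP => [[m' + ->]|md].
  by rewrite mem_enum inE => /eqP.
have lt_m : (mdeg m < d.+1)%N by rewrite md.
by exists (BMultinom lt_m) => //; rewrite mem_enum inE /= md.
Qed.

(* Main.v *)
Require Import Defs.
From HB Require Import structures.
From mathcomp Require Import all_boot all_order all_algebra.
From mathcomp Require Import boolp classical_sets fsbigop.
From mathcomp Require Import mpoly zify ring.
Set Implicit Arguments.
Unset Strict Implicit.
Unset Printing Implicit Defensive.
Import Order.TTheory GRing.Theory.
Local Open Scope ring_scope.

(* A minimal graded free resolution F exists because submodules of R^r are
   finitely generated (Dickson's lemma), and by comparison of resolutions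
   beta_{i,j} is the number of generators of F_i of degree j.  F_0 has one
   generator e_b for each monomial x^b of degree k.  A relation of degree k + qd
   splits, according to the monomial z of S_{k+qd} it lives over, into
   differences y^m e_b - y^m' e_b' of factorizations of z.  For q >= 2 and
   k >= 1 any two factorizations of z are linked by a chain in which neighbours
   share a variable y_i, and the difference of two neighbours is y_i times a
   relation of smaller degree.  Hence F_1 is generated in degree k + d, F_2 lives
   in degrees >= k + 2d, and the strands of F in degrees k + d and k + 2d are
   short exact complexes of vector spaces, whose dimensions give the Betti
   numbers. *)

(** * Dickson's lemma and finite generation *)

(** [betti] and [hilbert] are values chosen by [xget] with default 0, so a resolution and a basis
    must be exhibited before either carries information; hence a full minimal resolution is built,
    although only F_0, F_1 and F_2 matter. Exactness yields solutions of linear systems without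
    control of degrees, whence the recurring device of replacing a solution by its homogeneous part.
    The hypothesis on k is decisive: for k = 0 the module is cyclic and, as soon as n, d >= 2, has
    minimal relations y_i y_j - y_l y_m of degree 2d. The degrees of F_2 are bounded only from
    below, so only its generators of degree exactly k + 2d enter the last strand. With h_q = dim
    S_{k+qd}, r = rank F_1 and b = beta_{2,k+2d}, the strands say r + h_1 = N h_0 and b + C(N+1,2)
    h_0 = N r + h_2; eliminating r gives b = C(N,2) h_0 - N h_1 + h_2, the coefficient of z^{k+2d}
    in P. *)

(** The type varies with the index because the components of chain maps and homotopies are matrices
    whose sizes change from step to step. *)
Lemma dep_choice (T : nat -> Type) (P : forall i, T i -> Prop)
    (Q : forall i, T i -> T i.+1 -> Prop) :
  (exists x, P 0%N x) ->
  (forall i x, P i x -> exists y, P i.+1 y /\ Q i x y) ->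
  exists f : forall i, T i, forall i, P i (f i) /\ Q i (f i) (f i.+1).
Proof.
move=> /cid[x0 Px0] step.
pose nxt i (x : {x : T i | P i x}) : {y : T i.+1 | P i.+1 y} :=
  let s := cid (step i _ (svalP x)) in exist _ (sval s) (svalP s).1.
pose f := fix f i : {x : T i | P i x} :=
  if i is j.+1 then nxt j (f j) else exist _ x0 Px0.
exists (fun i => sval (f i)) => i; split; first exact: svalP.
exact: (svalP (cid (step i _ (svalP (f i))))).2.
Qed.

(** Every tail of [u] attains its minimum; the subsequence runs through positions whose value is
    minimal among all later ones. *)
Lemma nondecreasing_subsequence (u : nat -> nat) :
  exists2 g : nat -> nat, {homo g : i j / (i < j)%N} &
    {homo u \o g : i j / (i <= j)%N}.
Proof.
have min_after i : exists j, (i <= j)%N /\ forall l, (i <= l)%N -> (u j <= u l)%N.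
  have ex : exists v, `[< exists2 j, (i <= j)%N & u j = v >].
    by exists (u i); apply/asboolP; exists i.
  have [v /asboolP[j ij <-] vmin] := ex_minnP ex.
  by exists j; split=> // l il; apply: vmin; apply/asboolP; exists l.
pose P (_ j : nat) := forall l, (j <= l)%N -> (u j <= u l)%N.
have P0 : exists j, P 0%N j by have [j [_ jP]] := min_after 0%N; exists j => l _;
  apply: jP.
have step i x : P i x -> exists j, P i.+1 j /\ (x < j)%N.
  by move=> _; have [j [xj jP]] := min_after x.+1; exists j; split=> // l jl;
    apply: jP; apply: leq_trans jl.
have [g gP] := dep_choice P0 step.
exists g; first by apply: (homo_ltn ltn_trans) => i; exact: (gP i).2.
apply: (homo_leq leqnn leq_trans) => i /=.
by case: (gP i) => h /ltnW; apply: h.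
Qed.

(** Subsequences are extracted one coordinate at a time; each extraction preserves the monotonicity
    already obtained. *)
Lemma multinom_good_pair N (f : nat -> 'X_{1..N}) :
  exists i j, (i < j)%N /\ (f i <= f j)%MM.
Proof.
suff [g gmono fmono] : exists2 g : nat -> nat, {homo g : i j / (i < j)%N} &
    forall l : 'I_N, {homo (fun i => f (g i) l) : i j / (i <= j)%N}.
  exists (g 0%N), (g 1%N); split; first exact: gmono.
  by apply/mnm_lepP => l; apply: fmono.
suff /(_ N) [g gmono fmono] : forall c, exists2 g : nat -> nat,
    {homo g : i j / (i < j)%N} &
    forall l : 'I_N, (l < c)%N -> {homo (fun i => f (g i) l) : i j / (i <= j)%N}.
  by exists g => // l; apply: fmono.
elim=> [|c [g gmono fmono]]; first by exists id.
have [ltcN|leNc] := ltnP c N; last first.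
  by exists g => // l _; apply: fmono; apply: leq_trans leNc.
have [h hmono hP] := nondecreasing_subsequence (fun i => f (g i) (Ordinal ltcN)).
exists (g \o h) => [i j ij|l]; first exact/gmono/hmono.
rewrite ltnS leq_eqVlt => /predU1P[lc|lc] i j ij /=.
  by have -> : l = Ordinal ltcN; [exact: val_inj|exact: hP].
by apply: fmono => //; move: ij; rewrite leq_eqVlt => /predU1P[->//|/hmono/ltnW].
Qed.

Lemma dickson N (L : 'X_{1..N} -> Prop) : exists2 s : seq 'X_{1..N},
  (forall m, m \in s -> L m) &
  forall m, L m -> exists2 m', m' \in s & (m' <= m)%MM.
Proof.
apply: contrapT => nofin.
pose P (_ : nat) (s : seq 'X_{1..N}) := forall m, m \in s -> L m.
pose Q (_ : nat) (s t : seq 'X_{1..N}) :=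
  exists2 m, t = m :: s & forall m', m' \in s -> ~~ (m' <= m)%MM.
have step i s : P i s -> exists t, P i.+1 t /\ Q i s t.
  move=> Ls; apply: contrapT => nostep; apply: nofin; exists s => // m Lm.
  apply: contrapT => nodiv; apply: nostep; exists (m :: s); split.
    by move=> m'; rewrite inE => /predU1P[->|/Ls].
  exists m => // m' sm'; apply/negP => m'm; apply: nodiv; by exists m'.
have P0 : exists s, P 0%N s by exists [::].
have [F FP] := dep_choice P0 step.
(* Each [F i.+1] is a cons, so the default is never returned: [f i] is the monomial added at step i,
   divisible by no earlier one. *)
pose f i := head 0%MM (F i.+1).
have fF i j : (i < j)%N -> f i \in F j.
  elim: j => // j IH; rewrite ltnS leq_eqVlt /f.
  have [_ [m Fj _]] := FP j.
  by case/predU1P => [->|/IH]; rewrite Fj inE ?eqxx // => ->; rewrite orbT.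
have [i [j [ij fij]]] := multinom_good_pair f.
have [_ [m Fj]] := FP j; move=> /(_ _ (fF _ _ ij)); move: fij.
by rewrite {2}/f Fj /= => ->.
Qed.

Definition submodule (R : pzRingType) (V : lmodType R) (Z : V -> Prop) :=
  Z 0 /\ forall a u v, Z u -> Z v -> Z (a *: u + v).

Section Submodule.
Variables (R : pzRingType) (V : lmodType R) (Z : V -> Prop).
Hypothesis subZ : submodule Z.

Lemma submoduleZ a v : Z v -> Z (a *: v).
Proof. by move=> Zv; rewrite -[a *: v]addr0; apply: subZ.2 => //; exact: subZ.1. Qed.

Lemma submoduleD u v : Z u -> Z v -> Z (u + v).
Proof. by move=> Zu Zv; rewrite -[u]scale1r; exact: subZ.2. Qed.

Lemma submoduleB u v : Z u -> Z v -> Z (u - v).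
Proof. by move=> Zu Zv; rewrite -scaleN1r addrC; exact: subZ.2. Qed.

Lemma submodule_sum I (r : seq I) (P : pred I) (F : I -> V) :
  (forall i, P i -> Z (F i)) -> Z (\sum_(i <- r | P i) F i).
Proof. by move=> ZF; apply: big_ind => //; [exact: subZ.1|exact: submoduleD]. Qed.

End Submodule.

Lemma submodule_mulmx (R : pzRingType) s r (Z : 'rV[R]_r -> Prop)
    (G : 'M[R]_(s, r)) u :
  submodule Z -> (forall i, Z (row i G)) -> Z (u *m G).
Proof.
by move=> subZ ZG; rewrite mulmx_sum_row; apply: submodule_sum => // i _;
  exact: submoduleZ.
Qed.

Section Noetherian.
Variables (K : fieldType) (N : nat).
Local Notation R := {mpoly K[N]}.

Lemma lead_reduction (p q : R) : p != 0 -> q != 0 -> (mlead p <= mlead q)%MM ->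
  exists a, let q' := q - a * p in q' = 0 \/ (mlead q' < mlead q)%O.
Proof.
move=> p0 q0 le_pq.
pose c := mleadc q / mleadc p.
have c0 : c != 0 by rewrite mulf_neq0 ?invr_eq0 ?mleadc_eq0.
pose a : R := c *: 'X_[mlead q - mlead p].
have la : mlead a = (mlead q - mlead p)%MM.
  by rewrite mleadZ_proper ?mleadXm // mcoeffX eqxx mulr1.
have lca : mleadc a * mleadc p = mleadc q.
  by rewrite la mcoeffZ mcoeffX eqxx mulr1 divfK ?mleadc_eq0.
have lap0 : mlead (a * p) = (mlead a + mlead p)%MM.
  by rewrite mleadM_proper ?lca ?mleadc_eq0.
have lap : mlead (a * p) = mlead q by rewrite lap0 la submK.
have lc : (a * p)@_(mlead q) = mleadc q.
  by rewrite -[in LHS]lap lap0 mleadcM.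
exists a => /=; have [->|nz] := eqVneq (q - a * p) 0; [by left|right].
rewrite lt_neqAle (le_trans (mleadB_le _ _)) ?lap ?joinxx // andbT.
apply/eqP => E; move: nz; rewrite -mleadc_eq0 E mcoeffB lc.
by rewrite subrr eqxx.
Qed.

(** A Gröbner basis argument: Dickson's lemma selects finitely many elements whose leading monomials
    divide all those of [I], and division by them terminates because the monomial order is well
    founded. *)
Lemma ideal_fin_gen (I : R^o -> Prop) : submodule I ->
  exists s (p : 'I_s -> R), (forall i, I (p i)) /\
    forall q, I q -> exists u : 'rV[R]_s, q = \sum_i u 0 i * p i.
Proof.
move=> subI.
pose L m := exists p, [/\ I p, p != 0 & mlead p = m].
have [s sL Ldiv] := dickson L.
have /choice[p pP] (i : 'I_(size s)) : exists p, [/\ I p, p != 0 &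
  mlead p = nth 0%MM s i].
  by apply: sL; apply: mem_nth.
exists (size s), p; split=> [i|q]; first by case: (pP i).
move: {2}(mlead q) (erefl (mlead q)) => m; elim/(well_founded_ind (@ltom_wf N)): m q.
move=> m IH q qm Iq; have [->|q0] := eqVneq q 0.
  by exists 0; rewrite big1 // => i _; rewrite mxE mul0r.
have [|m' sm' m'm] := Ldiv m; first by exists q.
pose i : 'I_(size s) := Ordinal (etrans (index_mem m' s) sm').
have [Ip p0 pm] := pP i.
have {}pm : mlead (p i) = m' by rewrite pm nth_index.
have [|a] := @lead_reduction (p i) q p0 q0; first by rewrite pm qm.
have Iqa : I (q - a * p i) by apply: submoduleB => //; exact: (submoduleZ subI a Ip).
case=> [qa0|lt_qa].
  exists (a *: delta_mx 0 i); rewrite (bigD1 i) //= !mxE !eqxx mulr1 big1 => [|j ji].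
    by apply/eqP; rewrite addr0 -subr_eq0 qa0.
  by rewrite !mxE (negPf ji) ?andbF mulr0 mul0r.
have [u qu] : exists u : 'rV[R]_(size s), q - a * p i = \sum_j u 0 j * p j.
  by apply: (IH (mlead (q - a * p i))) => //; rewrite -qm.
exists (u + a *: delta_mx 0 i).
under eq_bigr do rewrite !mxE mulrDl.
rewrite big_split /= -qu (bigD1 i) //= !eqxx mulr1 big1 ?addr0 ?subrK // => j ji.
by rewrite (negPf ji) ?andbF mulr0 mul0r.
Qed.

(** Induction along R^r -> R^(1+r) -> R: the first coordinates form a finitely generated ideal, and
    the vectors with first coordinate zero are handled by the induction hypothesis. *)
Lemma submodule_fin_gen r (Z : 'rV[R]_r -> Prop) : submodule Z ->
  exists s (G : 'M[R]_(s, r)), forall w, Z w <-> exists u, w = u *m G.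
Proof.
elim: r Z => [|r IH] Z subZ.
  exists 0%N, 0 => w; have -> : w = 0 by apply/rowP; case.
  by split=> [_|_]; [exists 0; rewrite mul0mx|exact: subZ.1].
pose I (p : R^o) := exists w, Z w /\ w 0 0 = p.
have subI : submodule I.
  split=> [|a _ _ [u [Zu <-]] [v [Zv <-]]]; first by exists 0; rewrite mxE;
    split=> //; exact: subZ.1.
  by exists (a *: u + v); rewrite !mxE; split=> //; exact: subZ.2.
have [s1 [p [/choice[W WP] Ip]]] := ideal_fin_gen subI.
pose Z' (v : 'rV[R]_r) := Z (row_mx (0 : 'M_1) v).
have subZ' : submodule Z'.
  split=> [|a u v Zu Zv]; rewrite /Z'; first by rewrite row_mx0; exact: subZ.1.
  have -> : row_mx (0 : 'M_1) (a *: u + v) = a *: row_mx 0 u + row_mx 0 v.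
    by rewrite scale_row_mx add_row_mx scaler0 addr0.
  exact: subZ.2.
have [s2 [G GP]] := IH Z' subZ'.
pose G1 : 'M[R]_(s1, 1 + r) := \matrix_i W i.
pose G2 : 'M[R]_(s2, 1 + r) := row_mx 0 G.
exists (s1 + s2)%N, (col_mx G1 G2) => w; split=> [Zw|[u ->]]; last first.
  rewrite -[u]hsubmxK mul_row_col; apply: submoduleD => //;
    apply: submodule_mulmx => // i.
    by rewrite rowK; case: (WP i).
  rewrite -[row i G2]/(row i (row_mx 0 G)) row_row_mx row0.
  by apply/GP; exists (delta_mx 0 i); rewrite -rowE.
have [|u1 w0] := Ip (w 0 0); first by exists w.
pose v : 'M[R]_(1, 1 + r) := w - u1 *m G1.
have Zv : Z v.
  apply: submoduleB => //; apply: submodule_mulmx => // i.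
  by rewrite rowK; case: (WP i).
have v0 : lsubmx v = 0.
  apply/rowP => j; rewrite !mxE ord1 lshift0 w0; apply/eqP; rewrite subr_eq0; apply/eqP.
  by apply: eq_bigr => i _; rewrite mxE; case: (WP i) => _ ->.
have /GP[u2 vu2] : Z' (rsubmx v) by rewrite /Z' -v0 hsubmxK.
have uG2 : u2 *m G2 = row_mx 0 (u2 *m G) by rewrite /G2 mul_mx_row mulmx0.
exists (row_mx u1 u2); rewrite mul_row_col uG2 -vu2 -v0 hsubmxK.
by rewrite addrC subrK.
Qed.

End Noetherian.

(** * Homogeneous parts and minimal generators *)

Section Homogeneous.
Variables (K : fieldType) (N d : nat).
Local Notation R := {mpoly K[N]}.

(* [p] maps a generator of degree [s] to degree [c]. *)
Definition hom_shift (s c : nat) (p : R) :=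
  forall m, m \in msupp p -> (d * mdeg m + s)%N = c.

Definition hpart (s c : nat) (p : R) : R :=
  \sum_(m <- msupp p | (d * mdeg m + s)%N == c) p@_m *: 'X_[m].

Lemma mcoeff_hpart s c p m :
  (hpart s c p)@_m = if (d * mdeg m + s)%N == c then p@_m else 0.
Proof.
rewrite raddf_sum /=; under eq_bigr do rewrite mcoeffZ mcoeffX.
have [mp|mp] := boolP (m \in msupp p).
  rewrite big_mkcond (bigD1_seq m) ?msupp_uniq //= eqxx mulr1 big1 ?addr0 // => m' m'm.
  by rewrite (negPf m'm) mulr0 if_same.
rewrite (memN_msupp_eq0 mp) if_same big1_seq // => m' /andP[_ m'p].
by rewrite (_ : m' == m = false) ?mulr0 //; apply: contraNF mp => /eqP <-.
Qed.

Lemma hom_shiftP s c p :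
  hom_shift s c p <-> forall m, p@_m != 0 -> (d * mdeg m + s)%N = c.
Proof. by split=> h m; have := h m; rewrite mcoeff_msupp. Qed.

Lemma hpart_hom s c p : hom_shift s c (hpart s c p).
Proof. by apply/hom_shiftP => m; rewrite mcoeff_hpart; case: ifP => [/eqP->|_] //;
  rewrite eqxx. Qed.

Lemma hpart_id s c p : hom_shift s c p -> hpart s c p = p.
Proof.
move/hom_shiftP => h; apply/mpolyP => m; rewrite mcoeff_hpart.
by case: ifPn => //; rewrite eq_sym; apply: contraNeq; rewrite eq_sym => /h ->.
Qed.

Lemma hpart_is_additive s c : {morph hpart s c : p q / p - q}.
Proof.
move=> p q; apply/mpolyP => m; rewrite mcoeffB !mcoeff_hpart mcoeffB.
by case: ifP; rewrite ?subrr.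
Qed.

HB.instance Definition _ s c :=
  GRing.isZmodMorphism.Build R R (hpart s c) (@hpart_is_additive s c).

Lemma hpartM s s' c p q : hom_shift s s' q ->
  hpart s c (p * q) = hpart s' c p * q.
Proof.
move=> /hom_shiftP hq; apply/mpolyP => m; rewrite mcoeff_hpart !mcoeffM.
rewrite -[RHS](if_same ((d * mdeg m + s)%N == c)).
have E (k1 k2 : 'X_{1..N}) : m == (k1 + k2)%MM -> q@_k2 != 0 ->
    ((d * mdeg m + s)%N == c) = ((d * mdeg k1 + s')%N == c).
  by move=> /eqP-> /hq <-; rewrite mdegD mulnDr addnA.
case: ifP => mc; [apply: eq_bigr|rewrite big1 //] => k mk.
all: rewrite mcoeff_hpart; have [->|/(E _ _ mk)] := eqVneq q@_k.2 0;
  rewrite ?mulr0 // mc.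
  by move=> <-.
by move=> <-; rewrite mul0r.
Qed.

Lemma hpart_sum_lt B s p : (d * msize p + s < B)%N ->
  p = \sum_(c < B) hpart s c p.
Proof.
move=> leB; apply/mpolyP => m; rewrite raddf_sum /=.
under eq_bigr do rewrite mcoeff_hpart.
have [mp|/memN_msupp_eq0 ->] := boolP (m \in msupp p); last first.
  by rewrite big1 // => i _; rewrite if_same.
have ltB : (d * mdeg m + s < B)%N.
  by rewrite (leq_ltn_trans _ leB) // leq_add2r leq_mul2l ltnW ?orbT ?msize_mdeg_lt.
by rewrite (bigD1 (Ordinal ltB)) //= eqxx big1 ?addr0 // => c;
  rewrite -val_eqE eq_sym /= => /negPf ->.
Qed.

Definition hom_mx a b (ga : 'I_a -> nat) (gb : 'I_b -> nat) (A : 'M[R]_(a, b)) :=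
  forall i j, hom_shift (gb j) (ga i) (A i j).

Definition hpart_mx a b (ga : 'I_a -> nat) (gb : 'I_b -> nat) (A : 'M[R]_(a, b)) :=
  \matrix_(i, j) hpart (gb j) (ga i) (A i j).

Lemma hpart_mx_hom a b (ga : 'I_a -> nat) (gb : 'I_b -> nat) A :
  hom_mx ga gb (hpart_mx ga gb A).
Proof. by move=> i j; rewrite mxE; exact: hpart_hom. Qed.

Lemma hpart_mx_id a b (ga : 'I_a -> nat) (gb : 'I_b -> nat) A :
  hom_mx ga gb A -> hpart_mx ga gb A = A.
Proof. by move=> h; apply/matrixP => i j; rewrite mxE hpart_id. Qed.

Lemma hpart_mx_mul a b c (ga : 'I_a -> nat) (gb : 'I_b -> nat) (gc : 'I_c -> nat)
    (A : 'M_(a, b)) (B : 'M_(b, c)) :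
  hom_mx gb gc B -> hpart_mx ga gc (A *m B) = hpart_mx ga gb A *m B.
Proof.
move=> h; apply/matrixP => i j; rewrite !mxE raddf_sum; apply: eq_bigr => l _.
by rewrite /= mxE (hpartM _ _ (h l j)).
Qed.

Lemma hom_mx_mul a b c (ga : 'I_a -> nat) (gb : 'I_b -> nat) (gc : 'I_c -> nat)
    (A : 'M_(a, b)) (B : 'M_(b, c)) :
  hom_mx ga gb A -> hom_mx gb gc B -> hom_mx ga gc (A *m B).
Proof.
move=> hA hB; rewrite -(hpart_mx_id hA) -(hpart_mx_mul _ _ hB).
exact: hpart_mx_hom.
Qed.

(** A lift obtained row by row ignores degrees; its homogeneous part is still a lift, because
    projection commutes with multiplication by the homogeneous [B] and fixes [A]. *)
Lemma hom_mx_lift a b c (ga : 'I_a -> nat) (gb : 'I_b -> nat) (gc : 'I_c -> nat)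
    (A : 'M[R]_(a, c)) (B : 'M[R]_(b, c)) :
  hom_mx ga gc A -> hom_mx gb gc B ->
  (forall i, exists u, row i A = u *m B) ->
  exists2 U, hom_mx ga gb U & A = U *m B.
Proof.
move=> hA hB /choice[u uP]; exists (hpart_mx ga gb (\matrix_i u i)).
  exact: hpart_mx_hom.
rewrite -(hpart_mx_mul _ _ hB) -[LHS](hpart_mx_id hA); congr hpart_mx.
by apply/row_matrixP => i; rewrite row_mul rowK uP.
Qed.

Definition max_degree r (g : 'I_r -> nat) (w : 'rV[R]_r) :=
  (\sum_a (d * msize (w 0%R a) + g a)).+1%N.

Lemma hpart_row_sum B r (g : 'I_r -> nat) (w : 'rV[R]_r) : (max_degree g w <= B)%N ->
  w = \sum_(c < B) hpart_mx (fun=> c) g w.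
Proof.
move=> leB; apply/rowP => a; rewrite summxE; under eq_bigr do rewrite mxE.
by apply: hpart_sum_lt; apply: leq_trans leB; rewrite ltnS (bigD1 a) //= leq_addr.
Qed.

Lemma hom_shift_gcomp (M : gradedModule K N d) s c p (v : M) :
  hom_shift s c p -> gcomp s v -> gcomp c (p *: v).
Proof.
move=> hp sv; have [p0|] := eqVneq p 0; first by rewrite p0 scale0r; exact: gcomp0.
move=> p0; have /hp mc := mlead_supp p0; rewrite -mc; apply: gcompZ sv => m /hp.
by rewrite -mc => /addIn.
Qed.

Lemma gcompB (M : gradedModule K N d) c (u v : M) :
  gcomp c u -> gcomp c v -> gcomp c (u - v).
Proof.
move=> cu cv; apply: gcompD => //; rewrite -scaleN1r.
apply: hom_shift_gcomp cv; apply/hom_shiftP => m; rewrite mcoeffN mcoeff1.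
by have [->|_] := eqVneq m 0%MM; [rewrite mdeg0 muln0|rewrite oppr0 eqxx].
Qed.

Lemma gcomp_sum (M : gradedModule K N d) c I (r : seq I) (P : pred I) (F : I -> M) :
  (forall i, P i -> gcomp c (F i)) -> gcomp c (\sum_(i <- r | P i) F i).
Proof. by move=> h; apply: big_ind => //; [exact: gcomp0|exact: gcompD]. Qed.

Section Evaluation.
Variables (M : gradedModule K N d) (r : nat) (g : 'I_r -> nat) (aug : 'I_r -> M).

Definition ev (w : 'rV[R]_r) : M := \sum_a w 0 a *: aug a.

Lemma ev_is_linear : linear ev.
Proof.
move=> a u v; rewrite /ev scaler_sumr -big_split; apply: eq_bigr => i _ /=.
by rewrite !mxE scalerDl scalerA.
Qed.

HB.instance Definition _ := GRing.isLinear.Build R 'rV[R]_r M _ ev ev_is_linear.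

Hypothesis aug_hom : forall a, gcomp (g a) (aug a).

Lemma ev_hom c w : hom_mx (fun=> c) g w -> gcomp c (ev w).
Proof.
by move=> h; apply: gcomp_sum => a _; apply: hom_shift_gcomp (aug_hom a); apply: h.
Qed.

Lemma ev_hpart c w : gcomp c (ev w) -> ev (hpart_mx (fun=> c) g w) = ev w.
Proof.
(* [B] exceeds both [c] and all degrees occurring in [w]. Subtracting [ev w] in degree [c] makes the
   components sum to zero, and directness of the grading then kills each of them. *)
move=> hw; pose B := maxn c.+1 (max_degree g w).
pose s (j : 'I_B) : M :=
  ev (hpart_mx (fun=> val j) g w) - (if val j == c then ev w else 0).
have sj (j : 'I_B) : gcomp (val j) (s j).
  apply: gcompB; first by apply: ev_hom; exact: hpart_mx_hom.
  by case: eqP => [->|_] //; exact: gcomp0.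
have ltB : (c < B)%N by rewrite leq_maxl.
have s0 : \sum_j s j = 0.
  rewrite sumrB -linear_sum -hpart_row_sum ?leq_maxr // (bigD1 (Ordinal ltB)) //= eqxx.
  by rewrite big1 ?addr0 ?subrr // => j; rewrite -val_eqE /= => /negPf ->.
by have := gcomp_direct sj s0 (Ordinal ltB); rewrite /s /= eqxx => /eqP;
  rewrite subr_eq0 => /eqP.
Qed.

Lemma ev_lift w' c v : gcomp c v -> v = ev w' ->
  exists2 w, hom_mx (fun=> c) g w & v = ev w.
Proof.
move=> cv vw; exists (hpart_mx (fun=> c) g w'); first exact: hpart_mx_hom.
by rewrite ev_hpart -?vw.
Qed.

End Evaluation.

Definition graded_pred r (g : 'I_r -> nat) (Z : 'rV[R]_r -> Prop) :=
  forall c w, Z w -> Z (hpart_mx (fun=> c) g w).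

Definition row_span s r (D : 'M[R]_(s, r)) (w : 'rV[R]_r) := exists u, w = u *m D.

Definition row_gen s r (D : 'M[R]_(s, r)) (Z : 'rV[R]_r -> Prop) :=
  forall w, Z w <-> row_span D w.

Lemma row_span_row s r (D : 'M[R]_(s, r)) i : row_span D (row i D).
Proof. by exists (delta_mx 0 i); rewrite -rowE. Qed.

Lemma row_span_submodule s r (D : 'M[R]_(s, r)) : submodule (row_span D).
Proof.
split=> [|a _ _ [u ->] [v ->]]; first by exists 0; rewrite mul0mx.
by exists (a *: u + v); rewrite mulmxDl scalemxAl.
Qed.

(** Arbitrary generators are cut into their homogeneous parts, which stay in [Z]; the rows of [D]
    are indexed by pairs of a generator and a degree. *)
Lemma hom_fin_gen r (g : 'I_r -> nat) (Z : 'rV[R]_r -> Prop) :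
  submodule Z -> graded_pred g Z ->
  exists s (h : 'I_s -> nat) (D : 'M[R]_(s, r)), hom_mx h g D /\ row_gen D Z.
Proof.
move=> subZ gZ; have [s [G GP]] := submodule_fin_gen subZ.
pose B := \max_i max_degree g (row i G).
pose ix (x : 'I_#|{: 'I_s * 'I_B}|) := enum_val x.
pose h x : nat := (ix x).2.
pose D := \matrix_x hpart_mx (fun=> h x) g (row (ix x).1 G).
have subD := row_span_submodule D.
exists _, h, D; split=> [x a|w].
  by rewrite mxE; have := @hpart_mx_hom 1 r (fun=> h x) g (row (ix x).1 G) 0 a.
split=> [/GP[u ->]|[u ->]]; last first.
  apply: submodule_mulmx => // x; rewrite rowK; apply/gZ/GP.
  exact: row_span_row.
apply: (submodule_mulmx u subD) => i.
have leB : (max_degree g (row i G) <= B)%N by exact: leq_bigmax.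
rewrite (hpart_row_sum leB); apply: (submodule_sum subD) => c _.
have <- : row (enum_rank (i, c)) D = hpart_mx (fun=> val c) g (row i G).
  by rewrite rowK /h /ix enum_rankK.
exact: row_span_row.
Qed.

(* In a homogeneous generating set of minimal cardinality, a relation with a unit
   coefficient would make one of the generators redundant. *)
Lemma min_gen r (g : 'I_r -> nat) (Z : 'rV[R]_r -> Prop) :
  (0 < d)%N -> submodule Z -> graded_pred g Z ->
  exists s (h : 'I_s -> nat) (D : 'M[R]_(s, r)),
    [/\ hom_mx h g D, row_gen D Z &
        forall u : 'rV_s, u *m D = 0 -> forall a, (u 0 a)@_0%MM = 0].
Proof.
move=> d0 subZ gZ.
have ex : exists s, `[< exists (h : 'I_s ->
  nat) (D : 'M[R]_(s, r)), hom_mx h g D /\ row_gen D Z >].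
  by have [s hs] := hom_fin_gen subZ gZ; exists s; apply/asboolP.
have [s /asboolP[h [D [homD genD]]] smin] := ex_minnP ex.
exists s, h, D; split=> // u uD a; apply/eqP/negPn/negP => ua.
(* In the degree of generator [a] itself, the coefficient at [a] is reduced to its constant term,
   since d > 0; that generator can then be solved for. *)
pose v := hpart_mx (fun=> h a) h u.
have vD : v *m D = 0.
  by rewrite -(hpart_mx_mul _ _ homD) uD; apply/rowP => i; rewrite !mxE raddf0.
pose c := (u 0 a)@_0%MM; have c0 : c != 0 := ua.
have va : v 0 a = c%:MP.
  apply/mpolyP => m; rewrite mxE mcoeff_hpart mcoeffC.
  rewrite -{2}[h a]add0n eqn_add2r muln_eq0 -leqn0 leqNgt d0 /= mdeg_eq0.
  by case: eqP => [->|_]; rewrite ?mulr1 ?mulr0.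
move: v c c0 vD va => v c c0 vD va {uD}.
case: s h D homD genD smin u a ua v vD va => [|s] h D homD genD smin u a _ v vD va.
  by case: a va.
suff : (s.+1 <= s)%N by rewrite ltnn.
apply: smin; apply/asboolP; exists (h \o lift a), (row' a D); split.
  by move=> i j; rewrite mxE; exact: homD.
have subD' := row_span_submodule (row' a D).
have liftD j : row (lift a j) D = row j (row' a D) by apply/rowP => l; rewrite !mxE.
have rowD' i : row_span (row' a D) (row i D).
  have [j ->|->] := unliftP a i; first by rewrite liftD; exact: row_span_row.
  have -> : row a D = (- c^-1%:MP) *: \sum_j v 0 (lift a j) *: row (lift a j) D.
    move: vD; rewrite mulmx_sum_row (bigD1_ord a) //= va => /eqP.
    rewrite addrC addr_eq0 => /eqP->.
    by rewrite scaleNr scalerN opprK scalerA -mpolyCM mulVf // mpolyC1 scale1r.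
  apply: submoduleZ => //; apply: submodule_sum => // j _.
  by apply: submoduleZ => //; rewrite liftD; exact: row_span_row.
move=> w; split=> [/genD[u' ->]|[u' ->]]; first exact: submodule_mulmx.
by apply: submodule_mulmx => // i; apply/genD; rewrite -liftD; exact: row_span_row.
Qed.

End Homogeneous.

(** * Comparison of resolutions *)

(** The last hypothesis puts the kernel of the map induced by [phi] from Z to Z'/B' inside B;
    rank-nullity then compares Z/B with Z'/B'. *)
Lemma leq_rank_quotient (F : fieldType) m1 m2 m3 m4 p q (Z : 'M[F]_(m1, p))
    (B : 'M[F]_(m2, p)) (Z' : 'M[F]_(m3, q)) (B' : 'M[F]_(m4, q)) (phi : 'M[F]_(p, q)) :
  (B' <= Z')%MS -> (Z *m phi <= Z')%MS ->
  (forall z : 'rV_p, (z <= Z)%MS -> (z *m phi <= B')%MS -> (z <= B)%MS) ->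
  (\rank Z - \rank B <= \rank Z' - \rank B')%N.
Proof.
move=> BZ' ZZ' inj.
have := mxrank_mul_ker Z (phi *m cokermx B').
have := mxrank_mul_ker Z' (cokermx B').
have leB : (\rank (Z :&: kermx (phi *m cokermx B')) <= \rank B)%N.
  apply/mxrankS/row_subP => i; have := row_sub i (Z :&: kermx (phi *m cokermx B'))%MS.
  rewrite sub_capmx => /andP[zZ /sub_kermxP zB]; apply: inj => //.
  by rewrite submxE -mulmxA zB.
have leB' : (\rank B' <= \rank (Z' :&: kermx (cokermx B')))%N.
  by rewrite mxrankS // sub_capmx BZ'; apply/sub_kermxP; exact: mulmx_coker.
have leZ : (\rank (Z *m (phi *m cokermx B')) <= \rank (Z' *m cokermx B'))%N.
  by rewrite mulmxA mxrankS // submxMr.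
by move=> eZ' eZ; rewrite -eZ -eZ'; lia.
Qed.

Section Resolutions.
Variables (K : fieldType) (N d : nat) (M : gradedModule K N d).
Local Notation R := {mpoly K[N]}.
Local Notation res := (gradedFreeResolution M).
Local Notation m0 := (map_mx (mcoeff 0%MM)).

Lemma diff_hom (F : res) i : hom_mx d (gdeg (g := F) (i := i.+1)) (gdeg (i :=
  i)) (diff F i).
Proof. by move=> a b m /diff_homog. Qed.

Lemma diff_diff (F : res) i : diff F i.+1 *m diff F i = 0.
Proof.
apply/row_matrixP => a; rewrite row_mul row0; apply/diff_exact.
by exists (delta_mx 0 a); rewrite -rowE.
Qed.

Lemma aug_diff (F : res) a : ev (aug (g := F)) (row a (diff F 0)) = 0.
Proof. by apply/aug_exact; exists (delta_mx 0 a); rewrite -rowE. Qed.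

Definition chain_map (F G : res) (f : forall i, 'M[R]_(rk F i, rk G i)) :=
  [/\ forall i, hom_mx d (gdeg (i := i)) (gdeg (i := i)) (f i),
      forall a, ev (aug (g := G)) (row a (f 0%N)) = aug a &
      forall i, f i.+1 *m diff G i = diff F i *m f i].

Lemma ev_mulmx (F G : res) (f : 'M[R]_(rk F 0, rk G 0)) w :
  (forall a, ev (aug (g := G)) (row a f) = aug a) ->
  ev (aug (g := G)) (w *m f) = ev (aug (g := F)) w.
Proof.
move=> fa; rewrite mulmx_sum_row linear_sum; apply: eq_bigr => a _.
by rewrite linearZ /= fa.
Qed.

Lemma chain_map_exists (F G : res) : exists f, chain_map (F := F) (G := G) f.
Proof.
pose aug_compat i : 'M[R]_(rk F i, rk G i) -> Prop :=
  if i is 0%N then fun f => forall a, ev (aug (g := G)) (row a f) = aug a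
  else fun=> True.
(* The last clause says that the next lift is possible. Keeping it in the invariant lets one
   inductive step serve all degrees, with the augmentation confined to the initial case. *)
pose P i (f : 'M[R]_(rk F i, rk G i)) :=
  [/\ hom_mx d (gdeg (i := i)) (gdeg (i := i)) f, aug_compat i f &
      forall a, row_span (diff G i) (row a (diff F i *m f))].
pose Q i (f : 'M[R]_(rk F i, rk G i)) (f' : 'M[R]_(rk F i.+1, rk G i.+1)) :=
  f' *m diff G i = diff F i *m f.
have P0 : exists f, P 0%N f.
  have /choice[w wP] (a : 'I_(rk F 0)) : exists w : 'rV_(rk G 0),
      hom_mx d (fun=> gdeg a) (gdeg (i := 0%N)) w /\ aug a = ev (aug (g := G)) w.
    have [w0 aw] := aug_surj G (aug a).
    have [w hw ew] := ev_lift (aug_homog (g := G)) (aug_homog a) aw.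
    by exists w.
  have augw a : ev (aug (g := G)) (row a (\matrix_a w a)) = aug a.
    by rewrite rowK -(wP a).2.
  exists (\matrix_a w a); split=> //.
    by move=> a b; rewrite mxE; have := (wP a).1 0 b.
  by move=> a; apply/aug_exact; rewrite row_mul -[LHS]/(ev _ _) ev_mulmx // aug_diff.
have step i f : P i f -> exists f', P i.+1 f' /\ Q i f f'.
  case=> hf _ lf.
  have hF := hom_mx_mul (@diff_hom F i) hf.
  have [f' hf' ef'] := hom_mx_lift hF (@diff_hom G i) lf.
  exists f'; split=> //; split=> // a; apply/diff_exact.
  by rewrite -row_mul -mulmxA -ef' mulmxA diff_diff mul0mx row0.
have [f fP] := dep_choice P0 step.
exists f; split=> [i|a|i]; [by case: (fP i) => [[]]| |by case: (fP i)].
by case: (fP 0%N) => [[_ + _] _].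
Qed.

(** No homogeneity is asked of the homotopy: it serves only to show that a cycle maps to a boundary,
    and the cycle brings its own degree. *)
Lemma null_homotopy (F : res) (g : forall i, 'M[R]_(rk F i, rk F i)) :
  (forall a, ev (aug (g := F)) (row a (g 0%N)) = 0) ->
  (forall i, g i.+1 *m diff F i = diff F i *m g i) ->
  exists h : forall i, 'M[R]_(rk F i, rk F i.+1),
    g 0%N = h 0%N *m diff F 0 /\
    forall i, g i.+1 = h i.+1 *m diff F i.+1 + diff F i *m h i.
Proof.
move=> g0 gd.
have lift i (A : 'M[R]_(rk F i.+1, rk F i.+1)) : A *m diff F i = 0 ->
    exists h, A = h *m diff F i.+1.
  move=> Ad; have /choice[u uP] a : exists u, row a A = u *m diff F i.+1.
    by apply/diff_exact; rewrite -row_mul Ad row0.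
  by exists (\matrix_a u a); apply/row_matrixP => a; rewrite row_mul rowK.
(* The first clause makes [g i.+1 - diff F i *m h] vanish against [diff F i], which is the condition
   for the next lift. *)
pose P i (h : 'M[R]_(rk F i, rk F i.+1)) :=
  diff F i *m g i = diff F i *m h *m diff F i /\ (i = 0%N -> g i = h *m diff F i).
pose Q i (h : 'M[R]_(rk F i, rk F i.+1)) (h' : 'M[R]_(rk F i.+1, rk F i.+2)) :=
  g i.+1 = h' *m diff F i.+1 + diff F i *m h.
have P0 : exists h, P 0%N h.
  have /choice[u uP] a : exists u, row a (g 0%N) = u *m diff F 0.
    by apply/aug_exact; exact: g0.
  have eg : g 0%N = (\matrix_a u a) *m diff F 0.
    by apply/row_matrixP => a; rewrite row_mul rowK.
  by exists (\matrix_a u a); split=> //; rewrite -mulmxA -eg.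
have step i h : P i h -> exists h', P i.+1 h' /\ Q i h h'.
  move=> [hP _]; have [|h' eh'] := lift i (g i.+1 - diff F i *m h).
    by rewrite mulmxBl gd hP subrr.
  have Qh : Q i h h' by rewrite /Q -eh' subrK.
  exists h'; split=> //; split=> //.
  by rewrite Qh mulmxDr !mulmxA diff_diff mul0mx addr0.
have [h hP] := dep_choice P0 step.
exists h; split=> [|i]; last exact: (hP i).2.
exact: ((hP 0%N).1.2 (erefl _)).
Qed.

Lemma tor_diff_diff (F : res) i : tor_diff F i.+1 *m tor_diff F i = 0.
Proof. by rewrite -map_mxM diff_diff map_mx0. Qed.

Lemma tor_boundaries_cycles (F : res) i : (tor_diff F i <= tor_cycles F i)%MS.
Proof.
case: i => [|i] /=; first exact: submx1.
by apply/sub_kermxP; exact: tor_diff_diff.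
Qed.

Section ChainMap.
Variables (F G : res) (f : forall i, 'M[R]_(rk F i, rk G i)).
Hypothesis chain_f : chain_map f.

Lemma tor_chain_cycles i : (tor_cycles F i *m m0 (f i) <= tor_cycles G i)%MS.
Proof.
case: i => [|i] /=; first exact: submx1.
case: chain_f => _ _ fd; apply/sub_kermxP; rewrite -mulmxA -map_mxM fd map_mxM.
by rewrite mulmxA mulmx_ker mul0mx.
Qed.

Lemma tor_chain_boundaries i : (tor_diff F i *m m0 (f i) <= tor_diff G i)%MS.
Proof. by case: chain_f => _ _ fd; rewrite -map_mxM -fd map_mxM submxMl. Qed.

(** A homogeneous entry can have a nonzero constant term only between generators of equal degree, so
    a chain map respects the degree components of Tor. *)
Lemma tor_chain_part i j : tor_part F i j *m m0 (f i) = m0 (f i) *m tor_part G i j.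
Proof.
case: chain_f => hf _ _; apply/matrixP => a b.
rewrite mul_diag_mx mul_mx_diag !mxE.
have [->|nz] := eqVneq (f i a b)@_0%MM 0; first by rewrite mulr0 mul0r.
have /hom_shiftP/(_ _ nz) := hf i a b.
by rewrite mdeg0 muln0 add0n => ->; rewrite mulrC.
Qed.

End ChainMap.

(** The composite of comparison maps F -> G -> F is homotopic to the identity, so F -> G is
    injective on Tor. Exchanging F and G gives the reverse inequality. *)
Lemma tor_dim_le (F G : res) i j : (tor_dim F i j <= tor_dim G i j)%N.
Proof.
have [f chain_f] := chain_map_exists F G; have [g chain_g] := chain_map_exists G F.
apply: (leq_rank_quotient (phi := m0 (f i))).
- by rewrite capmxS ?tor_boundaries_cycles.
- rewrite sub_capmx (submx_trans (submxMr _ (capmxSl _ _))) ?tor_chain_cycles //=.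
  by rewrite (submx_trans (submxMr _ (capmxSr _ _))) // tor_chain_part // submxMl.
move=> z; rewrite !sub_capmx => /andP[zZ zP] /andP[zB _]; rewrite zP andbT.
pose k i := f i *m g i - 1%:M.
have [||h [h0 hS]] := @null_homotopy F k.
- move=> a; rewrite raddfB /= raddfB /= row_mul row1.
  case: chain_f => _ fa _; case: chain_g => _ ga _.
  rewrite (ev_mulmx _ ga) fa; apply/eqP; rewrite subr_eq0; apply/eqP.
  rewrite /ev (bigD1 a) //= mxE !eqxx scale1r big1 ?addr0 // => b ba.
  by rewrite mxE (negPf ba) andbF scale0r.
- move=> l; case: chain_f => _ _ fd; case: chain_g => _ _ gd.
  by rewrite mulmxBl mulmxBr mul1mx mulmx1 -mulmxA gd !mulmxA fd.
have zk : (z *m m0 (k i) <= tor_diff F i)%MS.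
  case: i z zZ {zP zB} => [|l] z zZ; first by rewrite h0 map_mxM mulmxA submxMl.
  rewrite hS map_mxD !map_mxM mulmxDr !mulmxA.
  have /sub_kermxP -> := zZ; by rewrite mul0mx addr0 submxMl.
have -> : z = z *m m0 (f i) *m m0 (g i) - z *m m0 (k i).
  by rewrite -mulmxA -map_mxM map_mxB map_mx1 mulmxBr mulmx1 opprB addrC subrK.
rewrite addmx_sub ?eqmx_opp //.
exact: submx_trans (submxMr _ zB) (tor_chain_boundaries chain_g i).
Qed.

Lemma betti_res (F : res) i j : betti M i j = tor_dim F i j.
Proof.
rewrite /betti; case: xgetP => [b _ [G ->]|];
  last by move/(_ (tor_dim F i j))/(_ (ex_intro _ F erefl)).
by apply/eqP; rewrite eqn_leq !tor_dim_le.
Qed.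

(** Minimality is phrased through kernels, the form in which [min_gen] supplies it: every kernel
    lies in (y_1, ..., y_N) F_i, so all differentials vanish after tensoring with K. *)
Definition minimal (F : res) :=
  (forall w, ev (aug (g := F)) w = 0 -> forall a, (w 0 a)@_0%MM = 0) /\
  (forall i (w : 'rV_(rk F i.+1)), w *m diff F i = 0 -> forall a, (w 0 a)@_0%MM = 0).

Lemma minimal_tor_diff (F : res) i : minimal F -> tor_diff F i = 0.
Proof.
case=> min0 minS; apply/matrixP => a b; rewrite !mxE.
have -> : diff F i a b = row a (diff F i) 0 b by rewrite mxE.
case: i a b => [|i] a b; first by apply: min0; exact: aug_diff.
by apply: minS; rewrite -row_mul diff_diff row0.
Qed.

Lemma betti_minimal (F : res) i j : minimal F -> betti M i j = \rank (tor_part F i j).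
Proof.
move=> minF; rewrite (betti_res F) /tor_dim minimal_tor_diff // cap0mx mxrank0 subn0.
suff cT : (1%:M <= tor_cycles F i)%MS by apply/eqmx_rank/andP;
  rewrite capmxSr sub_capmx submx_refl (submx_trans (submx1 _)).
case: i => [|i] /=; first exact: submx_refl.
by apply/sub_kermxP; rewrite minimal_tor_diff // mulmx0.
Qed.

End Resolutions.

(** * Construction of a minimal resolution *)

Section MinimalResolution.
Variables (K : fieldType) (N d : nat) (M : gradedModule K N d) (d_gt0 : (0 < d)%N).
Local Notation R := {mpoly K[N]}.

(** Ranks and degrees are bundled with the matrix, so that taking syzygies becomes an endomap of one
    type that can be iterated. *)
Record graded_mx := GradedMx {
  mx_tgt : nat; mx_tdeg : 'I_mx_tgt -> nat;
  mx_src : nat; mx_sdeg : 'I_mx_src -> nat;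
  mx_val : 'M[R]_(mx_src, mx_tgt);
  mx_hom : hom_mx d mx_sdeg mx_tdeg mx_val
}.

Definition no_unit s (Z : 'rV[R]_s -> Prop) := forall w, Z w ->
  forall a, (w 0 a)@_0%MM = 0.

Lemma ker_mx_submodule (A : graded_mx) :
  submodule (fun w : 'rV_(mx_src A) => w *m mx_val A = 0).
Proof.
split=> [|a u v u0 v0]; first exact: mul0mx.
by rewrite mulmxDl -scalemxAl u0 v0 scaler0 addr0.
Qed.

Lemma ker_mx_graded (A : graded_mx) :
  graded_pred d (mx_sdeg (g := A)) (fun w => w *m mx_val A = 0).
Proof.
move=> c w w0; rewrite -(hpart_mx_mul _ _ (@mx_hom A)) w0.
by apply/rowP => i; rewrite !mxE raddf0.
Qed.

(** A transparent definition: the target of [syzygies A] is convertible with the source of [A],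
    hence successive differentials compose without casts. *)
Definition syzygies (A : graded_mx) : graded_mx :=
  let s := cid (min_gen d_gt0 (ker_mx_submodule A) (@ker_mx_graded A)) in
  let h := cid (svalP s) in
  let D := cid (svalP h) in
  GradedMx (let: And3 p _ _ := svalP D in p).

Lemma syzygiesP (A : graded_mx) :
  row_gen (mx_val (syzygies A)) (fun w => w *m mx_val A = 0) /\
  no_unit (fun u : 'rV_(mx_src (syzygies A)) => u *m mx_val (syzygies A) = 0).
Proof. by have [] := svalP (cid (svalP (cid (svalP (cid (min_gen d_gt0
  (ker_mx_submodule A) (@ker_mx_graded A))))))). Qed.

Variables (r : nat) (g : 'I_r -> nat) (aug : 'I_r -> M).
Hypothesis aug_hom : forall a, gcomp (g a) (aug a).
Hypothesis aug_gen : forall v, exists w, v = ev aug w.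
Hypothesis aug_min : no_unit (fun w => ev aug w = 0).

Lemma ker_aug_submodule : submodule (fun w => ev aug w = 0).
Proof.
split=> [|a u v u0 v0]; first exact: linear0.
by rewrite linearP /= u0 v0 scaler0 addr0.
Qed.

Lemma ker_aug_graded : graded_pred d g (fun w => ev aug w = 0).
Proof. by move=> c w w0; rewrite ev_hpart // w0; exact: gcomp0. Qed.

Definition first_syzygies : graded_mx :=
  let s := cid (min_gen d_gt0 ker_aug_submodule ker_aug_graded) in
  let h := cid (svalP s) in
  let D := cid (svalP h) in
  GradedMx (let: And3 p _ _ := svalP D in p).

Lemma first_syzygiesP :
  row_gen (mx_val first_syzygies) (fun w => ev aug w = 0) /\
  no_unit (fun u : 'rV_(mx_src first_syzygies) => u *m mx_val first_syzygies = 0).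
Proof. by have [] := svalP (cid (svalP (cid (svalP (cid (min_gen d_gt0
  ker_aug_submodule ker_aug_graded)))))). Qed.

Fixpoint nth_syzygies i : graded_mx :=
  if i is j.+1 then syzygies (nth_syzygies j) else first_syzygies.

Lemma nth_syzygies_homog i a b m : m \in msupp (mx_val (nth_syzygies i) a b) ->
  (d * mdeg m + mx_tdeg (g := nth_syzygies i) b)%N = mx_sdeg (g := nth_syzygies i) a.
Proof. exact: mx_hom. Qed.

Lemma nth_syzygies_exact i (w : 'rV_(mx_tgt (nth_syzygies i.+1))) :
  w *m mx_val (nth_syzygies i) = 0 <->
  exists u, w = u *m mx_val (nth_syzygies i.+1).
Proof. exact: (syzygiesP (nth_syzygies i)).1. Qed.

Definition minimal_resolution : gradedFreeResolution M :=
  @GradedFreeResolution K N d M (fun i => mx_tgt (nth_syzygies i))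
    (fun i => mx_tdeg (g := nth_syzygies i)) (fun i => mx_val (nth_syzygies i)) aug
    nth_syzygies_homog aug_hom aug_gen first_syzygiesP.1 nth_syzygies_exact.

Lemma minimal_resolutionP : minimal minimal_resolution.
Proof.
split; first exact: aug_min.
by case=> [|i]; [exact: first_syzygiesP.2|exact: (syzygiesP (nth_syzygies i)).2].
Qed.

End MinimalResolution.

(** * Factorizations of monomials *)

Lemma multinom_between n (a z : 'X_{1..n}) e :
  (a <= z)%MM -> (mdeg a <= e <= mdeg z)%N ->
  exists c, [/\ (a <= c)%MM, (c <= z)%MM & mdeg c = e].
Proof.
move=> az; case/andP; elim: e => [|e IH].
  by rewrite leqn0 => /eqP a0 _; exists a; rewrite lepm_refl.
rewrite leq_eqVlt ltnS => /predU1P[ae _|ae ez]; first by exists a; rewrite lepm_refl.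
have [c [ac cz ce]] := IH ae (ltnW ez).
have [l ltl] : exists l, (c l < z l)%N.
  apply: contrapT => nol; move: ez; rewrite -ce ltnNge => /negP; apply.
  rewrite !mdegE leq_sum // => l _; rewrite leqNgt; apply/negP => ltl.
  by apply: nol; exists l.
exists (c + U_(l))%MM; split; last by rewrite mdegD mdeg1 ce addn1.
  exact: lepm_trans ac (lem_addr _ _).
apply/mnm_lepP => j; rewrite mnmDE mnm1E.
by case: eqP => [<-|_]; rewrite ?addn1 // addn0; apply/mnm_lepP.
Qed.

Lemma mdegBK n (a z : 'X_{1..n}) : (a <= z)%MM -> mdeg (z - a) = (mdeg z - mdeg a)%N.
Proof. by move=> az; rewrite -{2}(submK az) mdegD addnK. Qed.

Lemma lepm_mdeg_eq n (a b : 'X_{1..n}) : (a <= b)%MM -> mdeg a = mdeg b -> a = b.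
Proof.
move=> ab e; rewrite -[RHS](submK ab) (_ : b - a = 0)%MM ?add0m //.
by apply/eqP; rewrite -mdeg_eq0 mdegBK // e subnn.
Qed.

Lemma lepmPn n (a b : 'X_{1..n}) : ~~ (a <= b)%MM -> exists l, (b l < a l)%N.
Proof.
by move=> /forallPn[l]; rewrite -ltnNge; exists l.
Qed.

Section VeroneseMonomials.
Variables (n d k : nat).
Local Notation N := (expN n d).

(* The exponent of the image of the monomial y^m in S. *)
Definition ymon (m : 'X_{1..N}) : 'X_{1..n} := (\sum_i exp_a i *+ m i)%MM.

Lemma ymonD m1 m2 : ymon (m1 + m2) = (ymon m1 + ymon m2)%MM.
Proof.
rewrite /ymon -big_split; apply: eq_bigr => i _ /=; apply/mnmP => j.
by rewrite !mnmDE !mulmnE mulnDr.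
Qed.

Lemma ymonU i : ymon U_(i) = exp_a i.
Proof.
apply/mnmP => j; rewrite mnm_sumE (bigD1 i) //= mulmnE mnm1E eqxx muln1.
rewrite big1 ?addn0 // => l li; by rewrite mulmnE mnm1E eq_sym (negPf li) muln0.
Qed.

Lemma mdeg_ymon m : mdeg (ymon m) = (d * mdeg m)%N.
Proof.
rewrite mdeg_sum [mdeg m]mdegE big_distrr; apply: eq_bigr => i _ /=.
by rewrite mdegMn mdeg_exp_a.
Qed.

Definition factors (z : 'X_{1..n}) (m : 'X_{1..N}) (b : 'I_(expN n k)) :=
  z = (ymon m + exp_a b)%MM.

Lemma factors_deg z m b : factors z m b -> mdeg z = (d * mdeg m + k)%N.
Proof. by move->; rewrite mdegD mdeg_ymon mdeg_exp_a. Qed.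

(** Divisors of degree d, which are exponents of variables y_i, are split off until degree k
    remains. *)
Lemma factorization q z : mdeg z = (d * q + k)%N -> exists m b, factors z m b.
Proof.
elim: q z => [|q IH] z zq.
  have /exp_aP[b ->] : mdeg z = k by rewrite zq muln0.
  by exists 0%MM, b; rewrite /factors /ymon big1 ?add0m // => i _; rewrite mnm0E mulm0n.
have [||c [_ cz cd]] := @multinom_between n 0%MM z d.
  - by apply/mnm_lepP => i; rewrite mnm0E.
  - by rewrite mdeg0 zq mulnS -addnA leq_addr.
have /exp_aP[i ci] := cd.
have [|m [b zm]] := IH (z - c)%MM; first by rewrite mdegBK // cd zq; lia.
exists (m + U_(i))%MM, b; rewrite /factors ymonD ymonU -ci.
by rewrite -[LHS](submK cz) zm -!addmA [(c + _)%MM]addmC.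
Qed.

Lemma factorization_sub q z (A : 'X_{1..N}) : (ymon A <= z)%MM ->
  mdeg z = (d * (q + mdeg A) + k)%N -> exists m b, factors z (m + A) b.
Proof.
move=> Az zq; have [|m [b zm]] := @factorization q (z - ymon A)%MM.
  by rewrite mdegBK // mdeg_ymon zq; lia.
exists m, b; rewrite /factors ymonD -[LHS](submK Az) zm.
by rewrite -!addmA [(ymon A + _)%MM]addmC.
Qed.

Lemma factors_le z m b i : factors z m b -> (0 < m i)%N -> (exp_a i <= z)%MM.
Proof.
move=> -> mi; have le1 : (U_(i) <= m)%MM by rewrite lep1mP -lt0n.
rewrite -(submK le1) ymonD ymonU; apply: lepm_trans (lem_addr _ _); exact: lem_addl.
Qed.

(* For [q >= 2] and [k > 0], any two factorizations of [z] are linked by a chain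
   of factorizations in which neighbours share a variable: moving a_i1 one step
   towards a_i2 costs one extra unit of [z], and [k > 0] leaves room for a third
   a_j compatible with both. *)
Lemma factorization_connected q z (E : 'X_{1..N} -> 'I_(expN n k) ->
    'X_{1..N} -> 'I_(expN n k) -> Prop) :
  (0 < k)%N -> (0 < d)%N -> (2 <= q)%N -> mdeg z = (d * q + k)%N ->
  (forall m1 b1 m2 b2 m3 b3, E m1 b1 m2 b2 -> E m2 b2 m3 b3 -> E m1 b1 m3 b3) ->
  (forall m1 b1 m2 b2 i, factors z m1 b1 -> factors z m2 b2 ->
     (0 < m1 i)%N -> (0 < m2 i)%N -> E m1 b1 m2 b2) ->
  forall m1 b1 m2 b2, factors z m1 b1 -> factors z m2 b2 -> E m1 b1 m2 b2.
Proof.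
move=> k0 d0 q2 zq Etrans Estep m1 b1 m2 b2 z1 z2.
have var m b : factors z m b -> exists i, (0 < m i)%N.
  move/factors_deg; rewrite zq => /addIn/eqP; rewrite eqn_pmul2l // => /eqP qm.
  apply: contrapT => nom; have m0 : m = 0%MM.
    by apply/mnmP => i; rewrite mnm0E; apply/eqP; rewrite -leqn0 leqNgt;
      apply/negP => mi; apply: nom; exists i.
  by move: q2; rewrite qm m0 mdeg0.
have [[i1 m1i] [i2 m2i]] := (var _ _ z1, var _ _ z2).
(* Induction on a bound for the distance from a_i1 to a_i2, measured by the degree of their
   truncated difference. *)
move: {2}(mdeg _) (leqnn (mdeg (exp_a i1 - exp_a i2))) => t.
elim: t i1 m1 b1 z1 m1i => [|t IH] i1 m1 b1 z1 m1i.
  rewrite leqn0 mdeg_eq0 => /eqP a0; suff e12 : i1 = i2.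
    by apply: (Estep _ _ _ _ i2) => //; rewrite -e12.
  apply/exp_a_inj/lepm_mdeg_eq; last by rewrite !mdeg_exp_a.
  by apply/mnm_lepP => l; rewrite -subn_eq0 -mnmBE a0 mnm0E.
have [e12|ne12] := eqVneq i1 i2.
  by move=> _; apply: (Estep _ _ _ _ i2) => //; rewrite -e12.
have nle (i j : 'I_N) : i != j -> ~~ (exp_a i <= exp_a j)%MM.
  by apply: contraNN => le; apply/eqP/exp_a_inj/lepm_mdeg_eq; rewrite ?mdeg_exp_a.
have [l ltl] := lepmPn (nle _ _ ne12).
have [|l' ltl'] := lepmPn (nle i2 i1 _); first by rewrite eq_sym.
have a1z := factors_le z1 m1i; have a2z := factors_le z2 m2i.
(* a_i1 exceeds a_i2 at [l] and falls below it at [l']. Hence [w] still divides [z], and it is a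
   common multiple of a_i1 and of the next exponent a_i' = a_i1 - e_l + e_l'. *)
pose w := (exp_a i1 + U_(l'))%MM.
have ll' : l != l' by apply: contraTneq ltl => ->; rewrite -leqNgt ltnW.
have wz : (w <= z)%MM.
  apply/mnm_lepP => j; rewrite mnmDE mnm1E; case: eqP => [<-|_].
    by rewrite addn1 (leq_trans ltl') //; exact: (mnm_lepP a2z).
  by rewrite addn0; exact: (mnm_lepP a1z).
have ule : (U_(l) <= w)%MM by rewrite lep1mP mnmDE; lia.
have [|i' a'] := (exp_aP d (w - U_(l))%MM).1.
  by rewrite mdegBK // mdegD !mdeg1 mdeg_exp_a addnK.
have [||c [_ cz cd]] := @multinom_between n 0%MM (z - w)%MM d.
- by apply/mnm_lepP => j; rewrite mnm0E.
(* The cofactor has degree dq + k - (d + 1), which is at least d exactly because q >= 2 and k >=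
   1. *)
- rewrite mdeg0 mdegBK // mdegD mdeg1 mdeg_exp_a zq /=; nia.
have [j cj] := (exp_aP d c).1 cd.
have cwz : (c + w <= z)%MM by rewrite -(submK wz) /lem; apply/mnm_lepP => s;
  rewrite !mnmDE leq_add2r; exact: (mnm_lepP cz).
(* The two intermediate factorizations contain a_i1 a_j and a_i' a_j: the first shares a_i1 with the
   given one, and they share a_j with each other. *)
have [p3 [b3 z3]] : exists m b, factors z (m + (U_(i1) + U_(j))) b.
  apply: (@factorization_sub (q - 2)); last by rewrite mdegD !mdeg1 zq (subnK q2).
  rewrite ymonD !ymonU -cj; apply: lepm_trans cwz.
  by rewrite addmC /w addmA; exact: lem_addr.
have [p4 [b4 z4]] : exists m b, factors z (m + (U_(i') + U_(j))) b.
  apply: (@factorization_sub (q - 2)); last by rewrite mdegD !mdeg1 zq (subnK q2).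
  rewrite ymonD !ymonU -cj -a'; apply: lepm_trans cwz.
  by rewrite addmC -{2}(submK ule) addmA; exact: lem_addr.
move=> lt_t; apply: (Etrans _ _ (p3 + (U_(i1) + U_(j)))%MM b3).
  by apply: (Estep _ _ _ _ i1) => //; rewrite !mnmDE !mnm1E eqxx !addn_gt0 ?orbT.
apply: (Etrans _ _ (p4 + (U_(i') + U_(j)))%MM b4).
  by apply: (Estep _ _ _ _ j) => //; rewrite !mnmDE !mnm1E eqxx !addn_gt0 ?orbT.
apply: (IH i' _ _ z4); first by rewrite !mnmDE !mnm1E eqxx !addn_gt0 ?orbT.
rewrite -ltnS; apply: leq_trans lt_t.
have -> : (exp_a i1 - exp_a i2 = (exp_a i' - exp_a i2) + U_(l))%MM.
  apply/mnmP => s; rewrite -a' !(mnmDE, mnmBE, mnm1E).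
  case: (eqVneq l s) => [<-|ls]; first by rewrite eq_sym (negPf ll'); lia.
  by case: (eqVneq l' s) => [<-|l's]; lia.
by rewrite mdegD mdeg1 addn1.
Qed.

End VeroneseMonomials.

(** * Syzygies of the Veronese module *)

Section Coordinates.
Variables (K : fieldType) (N q r : nat).

(** Here [expN N q] counts the monomials of degree q in the y variables; rows of [c] are indexed by
    them. *)
Definition of_coords (c : 'M[K]_(expN N q, r)) : 'rV[{mpoly K[N]}]_r :=
  \row_b \sum_m c m b *: 'X_[exp_a m].

Definition coords (w : 'rV[{mpoly K[N]}]_r) : 'M[K]_(expN N q, r) :=
  \matrix_(m, b) (w 0 b)@_(exp_a m).

Definition homog_row (w : 'rV[{mpoly K[N]}]_r) :=
  forall b m, (w 0 b)@_m != 0 -> mdeg m = q.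

Lemma of_coordsK : cancel of_coords coords.
Proof.
move=> c; apply/matrixP => m b;
  rewrite !mxE raddf_sum (bigD1 m) //= mcoeffZ mcoeffX eqxx.
rewrite mulr1 big1 ?addr0 // => m' m'm; rewrite mcoeffZ mcoeffX.
by rewrite (inj_eq (@exp_a_inj _ _)) (negPf m'm) mulr0.
Qed.

Lemma of_coords_homog c : homog_row (of_coords c).
Proof.
move=> b m; apply: contraNeq => mq; rewrite mxE raddf_sum big1 //= => m' _.
rewrite mcoeffZ mcoeffX; case: eqP => [m'm|]; last by rewrite mulr0.
by rewrite -m'm mdeg_exp_a eqxx in mq.
Qed.

Lemma coordsK w : homog_row w -> of_coords (coords w) = w.
Proof.
move=> hw; apply/rowP => b; apply/mpolyP => m.
have [mq|/eqP mq] := eqVneq (mdeg m) q; last first.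
  have z0 v : homog_row v -> (v 0 b)@_m = 0.
    by move=> hv; apply/eqP/negPn/negP => /hv.
  by rewrite !z0 //; exact: of_coords_homog.
have /exp_aP[a ->] := mq.
transitivity (coords (of_coords (coords w)) a b); first by rewrite [RHS]mxE.
by rewrite of_coordsK mxE.
Qed.

Lemma coords_is_additive : {morph coords : u v / u - v}.
Proof. by move=> u v; apply/matrixP => m b; rewrite !mxE mcoeffB. Qed.

Lemma of_coords_is_additive : {morph of_coords : u v / u - v}.
Proof.
move=> u v; apply/rowP => b; rewrite !mxE -sumrB; apply: eq_bigr => m _.
by rewrite !mxE scalerBl.
Qed.

Lemma coordsZ a w : coords (a%:MP *: w) = a *: coords w.
Proof. by apply/matrixP => m b; rewrite !mxE mcoeffCM. Qed.

Lemma of_coordsZ a c : of_coords (a *: c) = a%:MP *: of_coords c.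
Proof.
apply/rowP => b; rewrite !mxE mul_mpolyC scaler_sumr; apply: eq_bigr => m _.
by rewrite mxE scalerA.
Qed.

Lemma of_coordsE c : of_coords c =
  \sum_b \sum_m (c m b)%:MP *: ('X_[exp_a m] *: delta_mx 0 b).
Proof.
apply/rowP => b; rewrite summxE (bigD1 b) //= [X in _ + X]big1 ?addr0 => [|b' b'b].
  rewrite [LHS]mxE summxE; apply: eq_bigr => m _.
  by rewrite !mxE !eqxx mulr1 mul_mpolyC.
by rewrite summxE big1 // => m _; rewrite !mxE eq_sym (negPf b'b) !mulr0.
Qed.

End Coordinates.

HB.instance Definition _ K N q r := GRing.isZmodMorphism.Build _ _
  (@coords K N q r) (@coords_is_additive K N q r).
HB.instance Definition _ K N q r := GRing.isZmodMorphism.Build _ _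
  (@of_coords K N q r) (@of_coords_is_additive K N q r).

Section VeroneseSyzygies.
Variables (K : fieldType) (n d k : nat).
Hypotheses (d_gt0 : (0 < d)%N) (k_gt0 : (0 < k)%N).
Local Notation N := (expN n d).
Local Notation R := {mpoly K[N]}.
Local Notation M := (veronese K n d k).
Local Notation rV := 'rV[R]_(expN n k).

Definition poly_of (v : M) : {mpoly K[n]} := vero_val v.

Lemma poly_of_inj : injective poly_of.
Proof. exact: val_inj. Qed.

Lemma poly_ofB u v : poly_of (u - v) = poly_of u - poly_of v.
Proof. by []. Qed.

Lemma poly_ofZ p v : poly_of (p *: v) = (p \mPo yimg K n d) * poly_of v.
Proof. by []. Qed.

Lemma in_veroneseP (p : {mpoly K[n]}) :
  (forall m, p@_m != 0 -> exists q, mdeg m = (d * q + k)%N) ->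
  in_veronese (n := n) (d := d) k p.
Proof.
move=> hp; apply/allP => m; rewrite mcoeff_msupp => /hp[q mq] /=.
by rewrite mq leq_addl addnK dvdn_mulr.
Qed.

Lemma poly_of_deg v m : (poly_of v)@_m != 0 -> exists q, mdeg m = (d * q + k)%N.
Proof.
rewrite -mcoeff_msupp => vm; case: v vm => v /= /allP vP /vP /andP[km /dvdnP[q mq]].
by exists q; rewrite mulnC -mq subnK.
Qed.

Lemma mon_in_veronese q m : mdeg m = (d * q + k)%N ->
  in_veronese (n := n) (d := d) k ('X_[m] : {mpoly K[n]}).
Proof.
move=> mq; apply: in_veroneseP => m'; rewrite mcoeffX.
by have [<- _|_] := eqVneq m m'; [exists q|rewrite eqxx].
Qed.

Lemma gen_in_veronese (b : 'I_(expN n k)) :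
  in_veronese (n := n) (d := d) k ('X_[exp_a b] : {mpoly K[n]}).
Proof. by apply: (@mon_in_veronese 0%N); rewrite mdeg_exp_a muln0. Qed.

Definition vgen (b : 'I_(expN n k)) : M := VeroneseS (gen_in_veronese b).

Lemma vgen_hom b : gcomp k (vgen b).
Proof. by rewrite /= /vero_comp /= dhomogX /= mdeg_exp_a. Qed.

Lemma comp_ymon m : 'X_[K, m] \mPo yimg K n d = 'X_[ymon m].
Proof.
rewrite comp_mpolyX; under eq_bigr do rewrite tnth_mktuple.
exact: mprodXnE.
Qed.

Lemma evZ a w : ev vgen (a *: w) = a *: ev vgen w.
Proof. exact: linearZ_LR. Qed.

Lemma evB u v : ev vgen (u - v) = ev vgen u - ev vgen v.
Proof. exact: raddfB. Qed.

Lemma evD u v : ev vgen (u + v) = ev vgen u + ev vgen v.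
Proof. exact: raddfD. Qed.

Lemma poly_ofD u v : poly_of (u + v) = poly_of u + poly_of v.
Proof. by []. Qed.

Lemma poly_of_ev w :
  poly_of (ev vgen w) = \sum_b (w 0 b \mPo yimg K n d) * 'X_[exp_a b].
Proof. by rewrite /poly_of /ev vero_val_sum. Qed.

Definition term (m : 'X_{1..N}) (b : 'I_(expN n k)) : rV := 'X_[m] *: delta_mx 0 b.

Lemma ev_delta b : ev vgen (delta_mx 0 b) = vgen b.
Proof.
rewrite /ev (bigD1 b) //= mxE !eqxx scale1r big1 ?addr0 // => b' b'b.
by rewrite mxE (negPf b'b) andbF scale0r.
Qed.

Lemma poly_of_term m b z : factors z m b -> poly_of (ev vgen (term m b)) = 'X_[z].
Proof.
by move=> ->; rewrite /term evZ ev_delta poly_ofZ comp_ymon mpolyXD.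
Qed.

Lemma vgen_gen v : exists w, v = ev vgen w.
Proof.
have /choice[f fP] (z : 'X_{1..n}) : exists w : rV,
    (poly_of v)@_z != 0 -> poly_of (ev vgen w) = 'X_[z].
  have [_|/poly_of_deg[q /factorization[m [b zmb]]]] := eqVneq ((poly_of v)@_z) 0.
    by exists 0.
  by exists (term m b) => _; exact: poly_of_term.
exists (\sum_(z <- msupp (poly_of v)) ((poly_of v)@_z)%:MP *: f z).
apply: poly_of_inj; rewrite [LHS]mpolyE linear_sum /=.
rewrite (big_morph poly_of (id1 := 0) (op1 := +%R)) //.
rewrite big_seq [RHS]big_seq; apply: eq_bigr => z; rewrite mcoeff_msupp => vz.
by rewrite evZ poly_ofZ comp_mpolyC mul_mpolyC fP.
Qed.

Lemma mcoeff_mulX n' (p : {mpoly K[n']}) m m' : mdeg m = mdeg m' ->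
  (p * 'X_[m])@_m' = p@_0 * (m == m')%:R.
Proof.
move=> mm'; have [<-|ne] := eqVneq m m'; first by rewrite -{1}[m]addm0 mcoeffMX mulr1.
rewrite mulr0; apply/eqP; rewrite mcoeff_eq0 (perm_mem (msuppMX _ _)).
apply: contraNN ne => /mapP[c _ m'c]; apply/eqP; move: mm'.
rewrite m'c mdegD -{1}[mdeg m]addn0 => /addnI/esym/eqP.
by rewrite mdeg_eq0 => /eqP->; rewrite addm0.
Qed.

Lemma mcoeff0_comp (p : R) : (p \mPo yimg K n d)@_0%MM = p@_0%MM.
Proof.
rewrite comp_mpolyEX raddf_sum /= [in RHS](mpolyE p) raddf_sum.
apply: eq_bigr => m _; rewrite /= !mcoeffZ comp_ymon !mcoeffX.
by rewrite -!mdeg_eq0 mdeg_ymon muln_eq0 [d == _]gtn_eqF.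
Qed.

(** In degree k only the constant terms of the coefficients contribute, and the generators are
    distinct monomials. *)
Lemma vgen_min : no_unit (fun w => ev vgen w = 0).
Proof.
move=> w w0 a; have := congr1 (mcoeff (exp_a a) \o poly_of) w0.
rewrite /= poly_of_ev raddf_sum (bigD1 a) //= mcoeff_mulX // eqxx mulr1.
rewrite big1 => [|b ba]; last first.
  by rewrite mcoeff_mulX ?mdeg_exp_a // (inj_eq (@exp_a_inj _ _)) (negPf ba) mulr0.
by rewrite addr0 mcoeff0_comp => ->; rewrite mcoeff0.
Qed.

(** The product of the ideal (y_1, ..., y_N) with the syzygy module; no member of a minimal
    generating set of syzygies lies in it. *)
Definition syz_m (w : rV) := exists v : 'I_N -> rV,
  (forall i, ev vgen (v i) = 0) /\ w = \sum_i 'X_i *: v i.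

Lemma syz_m_submodule : submodule syz_m.
Proof.
split=> [|a _ _ [u [u0 ->]] [v [v0 ->]]].
  by exists (fun=> 0); split=> [i|]; [exact: linear0|rewrite big1 // => i _;
    rewrite scaler0].
exists (fun i => a *: u i + v i); split=> [i|].
  by rewrite linearP /= u0 v0 scaler0 addr0.
rewrite scaler_sumr -big_split; apply: eq_bigr => i _ /=.
by rewrite scalerDr !scalerA mulrC.
Qed.

Lemma syz_m_term z m1 b1 m2 b2 i : factors z m1 b1 -> factors z m2 b2 ->
  (0 < m1 i)%N -> (0 < m2 i)%N -> syz_m (term m1 b1 - term m2 b2).
Proof.
move=> z1 z2 i1 i2.
have [le1 le2] : (U_(i) <= m1)%MM /\ (U_(i) <= m2)%MM by rewrite !lep1mP -!lt0n.
pose v := term (m1 - U_(i)) b1 - term (m2 - U_(i)) b2.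
have v0 : ev vgen v = 0.
  have e : (ymon (m1 - U_(i)) + exp_a b1 = ymon (m2 - U_(i)) + exp_a b2)%MM.
    apply/mnmP => j; have /mnmP/(_ j) := etrans (esym z1) z2.
    by rewrite -{1}(submK le1) -{1}(submK le2) !ymonD !mnmDE; lia.
  apply: poly_of_inj; rewrite evB poly_ofB.
  have z1' : factors (ymon (m1 - U_(i)) + exp_a b1)%MM (m1 - U_(i)) b1 by [].
  have z2' : factors (ymon (m1 - U_(i)) + exp_a b1)%MM (m2 - U_(i)) b2 by rewrite
    /factors e.
  by rewrite (poly_of_term z1') (poly_of_term z2') subrr.
exists (fun j => if j == i then v else 0); split=> [j|]; first by case: eqP => // _;
  exact: linear0.
rewrite (bigD1 i) //= eqxx big1 ?addr0 => [|j /negPf->]; last by rewrite scaler0.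
by rewrite scalerBr /term !scalerA -!mpolyXD [(U_(i) + _)%MM]addmC [(U_(i) + (m2 -
  _))%MM]addmC !submK.
Qed.

Lemma linear_syzygies q w : (2 <= q)%N -> homog_row q w -> ev vgen w = 0 -> syz_m w.
Proof.
move=> q2 hw w0.
have /choice[E EP] (z : 'I_(expN n (d * q + k))) :
    exists mb : 'X_{1..N} * 'I_(expN n k), factors (exp_a z) mb.1 mb.2.
  by have [|m [b zmb]] := @factorization n d k q (exp_a z);
    [exact: mdeg_exp_a|exists (m, b)].
(* A K-linear section of the augmentation in degree dq + k, sending each monomial to one chosen
   factorization. Connectedness gives [u - T (ev u)] in [syz_m] for every term, and a syzygy has
   [T (ev w) = 0]. *)
pose T (p : {mpoly K[n]}) : rV := \sum_z (p@_(exp_a z))%:MP *: term (E z).1 (E z).2.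
have TD : {morph T : p p' / p + p'}.
  move=> p p'; rewrite -big_split; apply: eq_bigr => z _.
  by rewrite mcoeffD mpolyCD scalerDl.
have T0 : T 0 = 0 by rewrite /T big1 // => z _; rewrite mcoeff0 mpolyC0 scale0r.
have sub := syz_m_submodule.
have termT m b : mdeg m = q -> syz_m (term m b - T (poly_of (ev vgen (term m b)))).
  move=> mq; pose z := (ymon m + exp_a b)%MM.
  have zq : mdeg z = (d * q + k)%N by rewrite (factors_deg (erefl z)) mq.
  have /exp_aP[iz ez] := zq.
  rewrite (poly_of_term (erefl z)) /T (bigD1 iz) //= mcoeffX ez eqxx mpolyC1 scale1r.
  rewrite big1 ?addr0 => [|j jz]; last first.
    by rewrite mcoeffX (inj_eq (@exp_a_inj _ _)) eq_sym (negPf jz) mpolyC0 scale0r.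
  have EPz : factors z (E iz).1 (E iz).2 by rewrite ez; exact: EP.
  pose rel m1 b1 m2 b2 := syz_m (term m1 b1 - term m2 b2).
  have rel_trans m1 b1 m2 b2 m3 b3 : rel m1 b1 m2 b2 -> rel m2 b2 m3 b3 ->
    rel m1 b1 m3 b3.
    move=> h12 h23; rewrite /rel -[term m1 b1](subrK (term m2 b2)) -addrA.
    exact: (submoduleD sub h12 h23).
  have rel_step m1 b1 m2 b2 i (z1 : factors z m1 b1) (z2 : factors z m2 b2)
      (i1 : (0 < m1 i)%N) (i2 : (0 < m2 i)%N) : rel m1 b1 m2 b2.
    exact: (syz_m_term z1 z2 i1 i2).
  exact: (factorization_connected k_gt0 d_gt0 q2 zq rel_trans rel_step (erefl z) EPz).
have TZ a p : T (a *: p) = a%:MP *: T p.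
  rewrite scaler_sumr; apply: eq_bigr => z _.
  by rewrite mcoeffZ mpolyCM scalerA.
pose P (u : rV) := syz_m (u - T (poly_of (ev vgen u))).
have P_sum I (r : seq I) (F : I -> rV) : (forall i, P (F i)) -> P (\sum_(i <- r) F i).
  move=> PF; apply: (big_ind P) => [|u v Pu Pv|i _]; last exact: PF.
    by rewrite /P linear0 T0 subr0; exact: sub.1.
  by rewrite /P evD poly_ofD TD opprD addrACA; exact: (submoduleD sub Pu Pv).
have PZ a u : P u -> P (a%:MP *: u).
  move=> Pu; rewrite /P evZ poly_ofZ comp_mpolyC mul_mpolyC TZ -scalerBr.
  exact: submoduleZ.
have : P w.
  rewrite -(coordsK hw) of_coordsE; apply: (P_sum) => b; apply: (P_sum) => m; apply: PZ.
  exact/termT/mdeg_exp_a.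
by rewrite /P w0 [poly_of 0]/= T0 subr0.
Qed.

End VeroneseSyzygies.

(** * Dimension counts *)

Lemma exact_dim (K : fieldType) (U V W : vectType K)
    (f : {linear U -> V}) (g : {linear V -> W}) :
  (forall v, g v = 0 <-> exists u, v = f u) ->
  (\dim (limg (linfun f)) + \dim (limg (linfun g)) = dim V)%N.
Proof.
move=> fg; have := limg_ker_dim (linfun g) fullv; rewrite dimvf capfv => <-.
congr (\dim _ + _)%N; apply/vspaceP => v; rewrite memv_ker lfunE /=.
apply/idP/eqP => [/memv_imgP[u _ ->]|/fg[u ->]].
  by rewrite lfunE /=; apply/fg; exists u.
by rewrite -[f u](lfunE f) memv_img ?memvf.
Qed.

Lemma inj_limg_dim (K : fieldType) (U V : vectType K) (f : {linear U -> V}) :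
  (forall u, f u = 0 -> u = 0) -> \dim (limg (linfun f)) = dim U.
Proof.
move=> f0; rewrite limg_dim_eq ?dimvf //; apply/eqP; rewrite -subv0 capfv.
apply/subvP => u; rewrite memv_ker lfunE /= => /eqP/f0->; exact: mem0v.
Qed.

Lemma surj_limg_dim (K : fieldType) (U V : vectType K) (f : {linear U -> V}) :
  (forall v, exists u, v = f u) -> \dim (limg (linfun f)) = dim V.
Proof.
move=> fs; rewrite -dimvf; congr (\dim _); apply/vspaceP => v; rewrite memvf.
by have [u ->] := fs v; rewrite -[f u](lfunE f) memv_img ?memvf.
Qed.

(** Images of the unit vectors show that some dimension exists. Any other basis is expressed by a
    matrix that is both row free and row full, so [xget] can only return [h]. *)
Lemma has_dim_iso (K : fieldType) (N d j h : nat) (M : gradedModule K N d)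
    (psi : 'rV[K]_h -> M) :
  (forall a c c', psi (a *: c + c') = a%:MP *: psi c + psi c') ->
  (forall c, psi c = 0 -> c = 0) -> (forall c, gcomp j (psi c)) ->
  (forall v, gcomp j v -> exists c, v = psi c) ->
  hilbert M j = h.
Proof.
move=> psi_lin psi_inj psi_hom psi_surj.
have psi0 : psi 0 = 0.
  by have := psi_lin (-1) 0 0; rewrite scaler0 addr0 mpolyCN mpolyC1 scaleN1r addNr.
have psiD : {morph psi : u v / u + v}.
  by move=> u v; have := psi_lin 1 u v; rewrite mpolyC1 !scale1r.
have psiZ a u : psi (a *: u) = a%:MP *: psi u.
  by have := psi_lin a u 0; rewrite psi0 !addr0.
have psi_sum b (c : 'rV_b) (A : 'M[K]_(b, h)) :
    \sum_a (c 0 a)%:MP *: psi (row a A) = psi (c *m A).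
  by rewrite mulmx_sum_row (big_morph psi psiD psi0); apply: eq_bigr => a _;
    rewrite psiZ.
have psi_injective : injective psi.
  move=> c c' cc'; apply/eqP; rewrite -subr_eq0; apply/eqP/psi_inj.
  have := psi_lin (-1) c' c; rewrite mpolyCN mpolyC1 !scaleN1r cc' addNr => <-.
  by rewrite addrC.
rewrite /hilbert; case: xgetP => [b _ [e ej eP]|]; last first.
  move/(_ h); case; exists (fun a => psi (row a 1%:M)) => // v jv.
  have [c ->] := psi_surj v jv; exists c; split; first by rewrite psi_sum mulmx1.
  by move=> c'; rewrite psi_sum mulmx1 => /psi_injective.
have /choice[A eA] a : exists c, e a = psi c by exact: psi_surj.
have sumA (c : 'rV_b) : \sum_a (c 0 a)%:MP *: e a = psi (c *m \matrix_a A a).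
  by rewrite -psi_sum; apply: eq_bigr => a _; rewrite rowK eA.
have freeA : row_free (\matrix_a A a).
  apply: inj_row_free => c cA; have [c0 [_ uniq_c]] := eP 0 (gcomp0 M j).
  rewrite -(uniq_c c) ?(uniq_c 0) //; last by rewrite sumA cA psi0.
  by rewrite sumA mul0mx psi0.
have fullA : row_full (\matrix_a A a).
  rewrite -sub1mx; apply/row_subP => i.
  have [c [/esym + _]] := eP _ (psi_hom (row i 1%:M)).
  by rewrite sumA => /psi_injective <-; exact: submxMl.
by rewrite -(eqP freeA) (eqP fullA).
Qed.

Section SCoordinates.
Variables (K : fieldType) (n e : nat).

(** One polynomial is treated as a row of length 1, which reuses the coordinates of rows for the
    components of S. *)
Definition of_scoords (c : 'rV[K]_(expN n e)) : {mpoly K[n]} := of_coords c^T 0 0.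
Definition scoords (p : {mpoly K[n]}) : 'rV[K]_(expN n e) :=
  (coords e (const_mx p : 'rV_1))^T.

Lemma of_scoordsK : cancel of_scoords scoords.
Proof.
move=> c; rewrite /scoords (_ : const_mx _ = of_coords c^T) ?of_coordsK ?trmxK //.
by apply/rowP => i; rewrite mxE ord1.
Qed.

Lemma scoordsK p : (forall m, p@_m != 0 -> mdeg m = e) -> of_scoords (scoords p) = p.
Proof.
by move=> hp; rewrite /of_scoords trmxK coordsK ?mxE // => b m; rewrite mxE; exact: hp.
Qed.

Lemma of_scoords_homog c m : (of_scoords c)@_m != 0 -> mdeg m = e.
Proof. exact: of_coords_homog. Qed.

Lemma scoords_linear : linear scoords.
Proof. by move=> a p q; apply/rowP => z; rewrite !mxE mcoeffD mcoeffZ. Qed.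

Lemma of_scoords_linear : linear of_scoords.
Proof.
move=> a c c'; rewrite /of_scoords linearP /= raddfD /= of_coordsZ !mxE.
by rewrite mul_mpolyC.
Qed.

End SCoordinates.

HB.instance Definition _ (K : fieldType) n e :=
  GRing.isLinear.Build K _ _ _ (@scoords K n e) (@scoords_linear K n e).
HB.instance Definition _ (K : fieldType) n e :=
  GRing.isLinear.Build K _ _ _ (@of_scoords K n e) (@of_scoords_linear K n e).

Section HomogeneousRows.
Variables (K : fieldType) (N d : nat) (d_gt0 : (0 < d)%N).
Local Notation R := {mpoly K[N]}.

Lemma hom_mx_homog_row q s r (w : 'rV[R]_r) :
  hom_mx d (fun=> (d * q + s)%N) (fun=> s) w <-> homog_row q w.
Proof.
split=> [h b m wm|h a b]; last first.
  by apply/hom_shiftP => m; rewrite ord1 => /h->.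
by have /hom_shiftP/(_ m wm)/addIn/eqP := h 0 b; rewrite eqn_pmul2l // => /eqP.
Qed.

Lemma hom_row_deg r c (g : 'I_r -> nat) (w : 'rV[R]_r) a m :
  hom_mx d (fun=> c) g w -> (w 0 a)@_m != 0 -> (d * mdeg m + g a)%N = c.
Proof. by rewrite -mcoeff_msupp => h; exact: h. Qed.

Lemma hpart_row_deg r c (g : 'I_r -> nat) (u : 'rV[R]_r) a m :
  (hpart_mx d (fun=> c) g u 0 a)@_m != 0 -> (d * mdeg m + g a)%N = c.
Proof. exact/hom_row_deg/hpart_mx_hom. Qed.

Lemma mcoeff_const (p : R) : (forall m, p@_m != 0 -> m = 0%MM) -> p = (p@_0)%:MP.
Proof.
move=> hp; apply/mpolyP => m; rewrite mcoeffC.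
have [->|m0] := eqVneq m 0%MM; first by rewrite mulr1.
by rewrite mulr0; apply/eqP/negPn/negP => /hp/eqP; rewrite (negPf m0).
Qed.

(** A zero row would make a basis vector, whose entry is a unit, a relation. *)
Lemma nonunit_entry r s (D : 'M[R]_(s, r)) a :
  no_unit (fun u : 'rV_s => u *m D = 0) -> (forall a b, (D a b)@_0 = 0) ->
  exists b m, (D a b)@_m != 0 /\ (0 < mdeg m)%N.
Proof.
move=> minD D0; have [b Db] : exists b, D a b != 0.
  apply: contrapT => nob; have : (delta_mx 0 a : 'rV_s) *m D = 0.
    rewrite -rowE; apply/rowP => b; rewrite !mxE; apply/eqP/negPn/negP => Db.
    by apply: nob; exists b.
  by move/minD/(_ a)/eqP; rewrite mxE !eqxx mcoeff1 eqxx oner_eq0.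
exists b, (mlead (D a b)); rewrite mleadc_eq0; split=> //.
rewrite lt0n mdeg_eq0; apply: contraNneq Db => l0.
by rewrite -mleadc_eq0 l0 D0.
Qed.

End HomogeneousRows.

(** * Strands of the resolution in degrees k + d and k + 2d *)

Section Strands.
Variables (K : fieldType) (n d k : nat) (d_gt0 : (0 < d)%N) (k_gt0 : (0 < k)%N).
Local Notation N := (expN n d).
Local Notation R := {mpoly K[N]}.
Local Notation M := (veronese K n d k).
Local Notation r0 := (expN n k).
Local Notation aug := (vgen K d (k := k)).
Local Notation h q := (expN n (d * q + k)).

Lemma vgen_hom_row q (c : 'M_(expN N q, r0)) :
  gcomp (d * q + k)%N (ev aug (of_coords c)).
Proof.
apply: (ev_hom (vgen_hom K d (k := k))); apply/hom_mx_homog_row => //.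
exact: of_coords_homog.
Qed.

Lemma gcomp_poly_of e (v : M) :
  gcomp e v <-> forall m, (poly_of v)@_m != 0 -> mdeg m = e.
Proof.
split=> [/dhomogP hv m|hv]; first by rewrite -mcoeff_msupp => /hv.
by apply/dhomogP => m; rewrite mcoeff_msupp => /hv.
Qed.

Lemma of_scoords_in_veronese q (c : 'rV[K]_(h q)) :
  in_veronese (n := n) (d := d) k (of_scoords c).
Proof. by apply: in_veroneseP => m /of_scoords_homog->; exists q. Qed.

Definition vero_of q (c : 'rV[K]_(h q)) : M := VeroneseS (of_scoords_in_veronese c).

Lemma vero_of_gcomp q c : gcomp (d * q + k)%N (@vero_of q c).
Proof. by apply/gcomp_poly_of => m; exact: of_scoords_homog. Qed.

Lemma vero_of_surj q v : gcomp (d * q + k)%N v ->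
  v = @vero_of q (scoords (d * q + k) (poly_of v)).
Proof.
by move/gcomp_poly_of => hv; apply: poly_of_inj; rewrite /poly_of /= scoordsK.
Qed.

Lemma hilbert_veronese q : hilbert M (d * q + k)%N = h q.
Proof.
apply: (has_dim_iso (psi := @vero_of q)).
- move=> a c c'; apply: poly_of_inj.
  by rewrite poly_ofD poly_ofZ comp_mpolyC mul_mpolyC; exact: of_scoords_linear.
- move=> c /(congr1 (@poly_of _ _ _ _)) c0; rewrite -[c]of_scoordsK.
  by rewrite -[of_scoords c]/(poly_of (vero_of c)) c0; apply/rowP => i;
    rewrite !mxE mcoeff0.
- exact: vero_of_gcomp.
- by move=> v /vero_of_surj ->; exists (scoords (d * q + k) (poly_of v)).
Qed.

Lemma hilbert_veronese_lt j : (j < k)%N -> hilbert M j = 0%N.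
Proof.
move=> jk; apply: (has_dim_iso (psi := fun=> 0)).
- by move=> a c c'; rewrite scaler0 addr0.
- by move=> c _; apply/rowP; case.
- by move=> c; exact: gcomp0.
move=> v /gcomp_poly_of hv; exists 0; apply: poly_of_inj; apply/mpolyP => m.
rewrite [RHS]mcoeff0; apply/eqP/negPn/negP => vm.
have [q] := poly_of_deg vm; rewrite (hv m vm) => jq.
by move: jk; rewrite jq ltnNge leq_addl.
Qed.

Variables (r1 r2 : nat) (g1 : 'I_r1 -> nat) (g2 : 'I_r2 -> nat).
Variables (D0 : 'M[R]_(r1, r0)) (D1 : 'M[R]_(r2, r1)).
Hypothesis hom0 : hom_mx d g1 (fun=> k) D0.
Hypothesis hom1 : hom_mx d g2 g1 D1.
Hypothesis exact0 : forall w, ev aug w = 0 <-> exists u, w = u *m D0.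
Hypothesis exact1 : forall w : 'rV_r1, w *m D0 = 0 <-> exists u, w = u *m D1.
Hypothesis min0 : no_unit (fun u : 'rV_r1 => u *m D0 = 0).
Hypothesis min1 : no_unit (fun u : 'rV_r2 => u *m D1 = 0).

Lemma ev_row_D0 a : ev aug (row a D0) = 0.
Proof. by apply/exact0; exists (delta_mx 0 a); rewrite -rowE. Qed.

Lemma row_D1_D0 a : row a D1 *m D0 = 0.
Proof. by apply/exact1; exists (delta_mx 0 a); rewrite -rowE. Qed.

Lemma D0_nonunit a b : (D0 a b)@_0%MM = 0.
Proof. by have := vgen_min d_gt0 (ev_row_D0 a) b; rewrite mxE. Qed.

Lemma D1_nonunit a b : (D1 a b)@_0%MM = 0.
Proof. by have := min0 (row_D1_D0 a) b; rewrite mxE. Qed.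

(** Absence of constant terms puts the degree at k + d or above. From k + 2d on, the generator would
    lie in [syz_m], against minimality. *)
Lemma gdeg1E a : g1 a = (d * 1 + k)%N.
Proof.
have [b [m [Dm m0]]] := nonunit_entry a min0 D0_nonunit.
have /hom_shiftP/(_ m Dm) <- := @hom0 a b.
case E : (mdeg m) m0 => [//|[|q]] _; first by [].
have hrow : homog_row q.+2 (row a D0).
  apply/(hom_mx_homog_row d_gt0 _ k) => i b'; rewrite ord1 mxE.
  by rewrite -E (_ : (_ + _)%N = g1 a) //; have /hom_shiftP/(_ m Dm) := @hom0 a b.
have [v [v0 rowE']] := linear_syzygies d_gt0 k_gt0 (isT :
  (2 <= q.+2)%N) hrow (ev_row_D0 a).
have /choice[u uP] i : exists u, v i = u *m D0 by apply/exact0.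
(* Writing row [a] as a combination of the y_i times syzygies yields a relation among generators
   whose coefficient at [a] has constant term 1. *)
have /min0/(_ a)/eqP : ((delta_mx 0 a : 'rV_r1) - \sum_i 'X_i *: u i) *m D0 = 0.
  rewrite mulmxBl -rowE rowE' mulmx_suml -sumrB big1 // => i _.
  by rewrite -scalemxAl -uP subrr.
rewrite !mxE summxE !eqxx mcoeffB mcoeff1 eqxx raddf_sum big1 ?subr0 ?oner_eq0 // =>
  i _.
by rewrite mxE /= rmorphM /= mcoeffX mnm1_eq0 mul0r.
Qed.

Lemma gdeg2_ge a : (d * 2 + k <= g2 a)%N.
Proof.
have [b [m [Dm m0]]] := nonunit_entry a min1 D1_nonunit.
by have /hom_shiftP/(_ m Dm) <- := @hom1 a b;
  rewrite gdeg1E addnA leq_add2r -mulnDr leq_mul2l addn1 ltnS m0 orbT.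
Qed.

Definition aug_strand q (c : 'M[K]_(expN N q, r0)) : 'rV[K]_(h q) :=
  scoords _ (poly_of (ev aug (of_coords c))).

(** The generators of F_1 have degree k + d, so coefficients of degree q land in degree q + 1 over
    F_0. *)
Definition strand1 q (c : 'M[K]_(expN N q, r1)) : 'M[K]_(expN N q.+1, r0) :=
  coords q.+1 (of_coords c *m D0).

(* In degree 2d+k, a generator of degree 2d+k contributes its scalar multiples only. *)
Definition lin_part := diag_mx (\row_a (g2 a == d * 2 + k)%N%:R) : 'M[K]_r2.

(** The source uses coordinates in a row basis, so that its dimension is the rank defining the Betti
    number. *)
Definition strand2 (c : 'rV[K]_(\rank lin_part)) : 'M[K]_(expN N 1, r1) :=
  coords 1 (map_mx (@mpolyC N K) (c *m row_base lin_part) *m D1).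

Lemma aug_strand_linear q : linear (@aug_strand q).
Proof.
move=> a c c'; rewrite /aug_strand raddfD /= of_coordsZ evD evZ poly_ofD poly_ofZ.
by rewrite comp_mpolyC mul_mpolyC; exact: scoords_linear.
Qed.

Lemma strand1_linear q : linear (@strand1 q).
Proof.
move=> a c c'; rewrite /strand1 raddfD /= of_coordsZ mulmxDl -scalemxAl raddfD /=.
by rewrite coordsZ.
Qed.

Lemma strand2_linear : linear strand2.
Proof.
move=> a c c'; rewrite /strand2 mulmxDl -scalemxAl map_mxD map_mxZ mulmxDl -scalemxAl.
by rewrite raddfD /= coordsZ.
Qed.

HB.instance Definition _ q :=
  GRing.isLinear.Build K _ _ _ (@aug_strand q) (@aug_strand_linear q).
HB.instance Definition _ q :=
  GRing.isLinear.Build K _ _ _ (@strand1 q) (@strand1_linear q).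
HB.instance Definition _ := GRing.isLinear.Build K _ _ _ strand2 strand2_linear.

Lemma aug_strand_eq0 q c : @aug_strand q c = 0 <-> ev aug (of_coords c) = 0.
Proof.
split=> [c0|c0]; last by rewrite /aug_strand c0; apply/rowP => z; rewrite !mxE mcoeff0.
by rewrite (vero_of_surj (vgen_hom_row c)) -[scoords _ _]/(aug_strand c) c0;
  apply: poly_of_inj; rewrite /poly_of /=; exact: linear0.
Qed.

Lemma aug_strand_surj q v : exists c, v = @aug_strand q c.
Proof.
have [w0 vw0] := vgen_gen (vero_of v).
have [w hw vw] := ev_lift (vgen_hom K d (k := k)) (vero_of_gcomp v) vw0.
exists (coords q w); rewrite /aug_strand coordsK;
  last exact/(hom_mx_homog_row d_gt0 _ k).
by rewrite -vw of_scoordsK.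
Qed.

Lemma strand1_homog q (c : 'M[K]_(expN N q, r1)) : homog_row q.+1 (of_coords c *m D0).
Proof.
apply/(hom_mx_homog_row d_gt0 _ k); apply: (hom_mx_mul _ hom0) => i a.
apply/hom_shiftP => m; rewrite ord1 gdeg1E => /of_coords_homog ->.
by rewrite mulnS; lia.
Qed.

Lemma strand_exact q c : @aug_strand q.+1 c = 0 <-> exists u, c = @strand1 q u.
Proof.
rewrite aug_strand_eq0 exact0; split=> [[u cu]|[u ->]]; last first.
  by rewrite /strand1 coordsK; [exists (of_coords u)|exact: strand1_homog].
pose u' := hpart_mx d (fun=> (d * q.+1 + k)%N) g1 u.
have cu' : of_coords c = u' *m D0.
  rewrite -(hpart_mx_mul _ _ hom0) -cu hpart_mx_id //.
  by apply/hom_mx_homog_row => //; exact: of_coords_homog.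
exists (coords q u'); rewrite /strand1 coordsK; first by rewrite -cu' of_coordsK.
move=> a m /hpart_row_deg; rewrite gdeg1E => e; apply/eqP;
  rewrite -(eqn_pmul2l d_gt0); apply/eqP; nia.
Qed.

(** Coefficients of degree 0 are constants, and minimality excludes a relation with a nonzero
    constant term. *)
Lemma strand1_inj c : @strand1 0 c = 0 -> c = 0.
Proof.
move=> c0; have cD : of_coords c *m D0 = 0.
  by rewrite -(coordsK (@strand1_homog _ c)) -[coords _ _]/(strand1 c) c0 raddf0.
rewrite -[c]of_coordsK; suff -> : of_coords c = 0 by rewrite raddf0.
apply/rowP => a; rewrite [RHS]mxE (@mcoeff_const _ _ (of_coords c 0 a)).
  by rewrite (min0 cD) mpolyC0.
by move=> m /of_coords_homog/eqP; rewrite mdeg_eq0 => /eqP.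
Qed.

Lemma lin_partP (y : 'rV[K]_r2) :
  (y <= lin_part)%MS <-> forall a, y 0 a != 0 -> g2 a = (d * 2 + k)%N.
Proof.
split=> [/submxP[x ->] a|hy].
  rewrite mul_mx_diag !mxE; have [//|_] := eqVneq (g2 a) (d * 2 + k)%N.
  by rewrite mulr0n mulr0 eqxx.
apply/submxP; exists y; apply/rowP => a; rewrite mul_mx_diag !mxE.
by have [->|/hy->] := eqVneq (y 0 a) 0; rewrite ?mul0r // eqxx mulr1.
Qed.

Lemma strand2_homog c : homog_row 1 (map_mx (@mpolyC N K) (c *m row_base lin_part) *m
  D1).
Proof.
have /lin_partP hy : (c *m row_base lin_part <= lin_part)%MS.
  by rewrite -(eq_row_base lin_part) submxMl.
move=> b m bm.
have hw : hom_mx d (fun=> (d * 2 + k)%N) g2 (map_mx (@mpolyC N K) (c *m row_base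
  lin_part)).
  move=> i a; apply/hom_shiftP => m'; rewrite ord1 mxE mcoeffC.
  have [->|_] := eqVneq m' 0%MM; last by rewrite mulr0 eqxx.
  by rewrite mulr1 mdeg0 muln0 => /hy.
have := hom_row_deg (hom_mx_mul hw hom1) bm.
rewrite gdeg1E => e; apply/eqP; rewrite -(eqn_pmul2l d_gt0); apply/eqP; nia.
Qed.

Lemma strand2_inj c : strand2 c = 0 -> c = 0.
Proof.
move=> c0; set w := map_mx (@mpolyC N K) (c *m row_base lin_part).
have wD : w *m D1 = 0.
  by rewrite -(coordsK (@strand2_homog c)) -[coords _ _]/(strand2 c) c0 raddf0.
have cB : c *m row_base lin_part = 0.
  apply/rowP => a; have := min1 wD a.
  by rewrite [w 0 a]mxE mcoeffC eqxx mulr1 => ->; rewrite mxE.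
by apply: (row_free_inj (row_base_free lin_part)); rewrite /= cB mul0mx.
Qed.

Lemma strand2_exact c : @strand1 1 c = 0 <-> exists u, c = strand2 u.
Proof.
have -> : strand1 c = 0 <-> of_coords c *m D0 = 0.
  split=> [c0|c0]; last by rewrite /strand1 c0 raddf0.
  by rewrite -(coordsK (@strand1_homog _ c)) -[coords _ _]/(strand1 c) c0 raddf0.
rewrite exact1; split=> [[u cu]|[u ->]]; last first.
  by rewrite /strand2 coordsK; [eexists|exact: strand2_homog].
have hc : hom_mx d (fun=> (d * 2 + k)%N) g1 (of_coords c).
  move=> i a; apply/hom_shiftP => m; rewrite ord1 gdeg1E => /of_coords_homog ->.
  by lia.
pose u' := hpart_mx d (fun=> (d * 2 + k)%N) g2 u.
have cu' : of_coords c = u' *m D1.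
  by rewrite -(hpart_mx_mul _ _ hom1) -cu hpart_mx_id.
have hu' a m : (u' 0 a)@_m != 0 -> (d * mdeg m + g2 a = d * 2 + k)%N.
  exact: hpart_row_deg.
(* All generators of F_2 have degree at least 2d + k, so in degree 2d + k their coefficients can
   only be scalars. *)
have u'const a m : (u' 0 a)@_m != 0 -> m = 0%MM.
  move/hu' => e; apply/eqP; rewrite -mdeg_eq0 -leqn0 -(leq_pmul2l d_gt0) muln0.
  by have := gdeg2_ge a; lia.
pose y : 'rV[K]_r2 := \row_a (u' 0 a)@_0%MM.
have u'y : u' = map_mx (@mpolyC N K) y.
  apply/rowP => a; rewrite [RHS]mxE [y 0 a]mxE.
  by apply: mcoeff_const => m; exact: u'const.
have yT : (y <= row_base lin_part)%MS.
  rewrite eq_row_base; apply/lin_partP => a; rewrite mxE => /hu'.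
  by rewrite mdeg0 muln0.
have /submxP[c' yc'] := yT.
by exists c'; rewrite /strand2 -yc' -u'y -cu' of_coordsK.
Qed.

Lemma strand_dim0 : (expN N 0 * r1 + h 1 = expN N 1 * r0)%N.
Proof.
have := exact_dim (@strand_exact 0).
rewrite (surj_limg_dim (@aug_strand_surj 1)) (inj_limg_dim strand1_inj).
by rewrite !dim_matrix /= mul1r.
Qed.

Lemma strand_dim1 : (\rank lin_part + expN N 2 * r0 = expN N 1 * r1 + h 2)%N.
Proof.
have := exact_dim (@strand_exact 1); have := exact_dim strand2_exact.
rewrite (surj_limg_dim (@aug_strand_surj 2)) (inj_limg_dim strand2_inj).
(* [x] is the dimension of the image of F_1 in F_0, common to the two exactness counts. *)
rewrite !dim_matrix !mul1r; set x := \dim _ => e2 e1.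
have {}e2 : (\rank lin_part + x = expN N 1 * r1)%N := e2.
have {}e1 : (x + h 2 = expN N 2 * r0)%N := e1.
by rewrite -e1 -e2 addnA.
Qed.

End Strands.

(** * Coefficients of P(z) and comparison with the Betti numbers *)

Lemma coef_one_sub_X_exp n j :
  ((1 - 'X) ^+ n : {poly int})`_j = (-1) ^+ j * 'C(n, j)%:Z.
Proof.
elim: n j => [|n IH] [|j]; rewrite ?expr0 ?coef1 ?mulr0 ?bin0 //.
  by rewrite exprS mulrBl !mul1r coefB coefXM eqxx subr0 IH bin0.
rewrite exprS mulrBl mul1r coefB coefXM /= !IH binS PoszD exprS; ring.
Qed.

Lemma coef_one_sub_Xn_exp n d l : (0 < d)%N ->
  ((1 - 'X^d) ^+ n : {poly int})`_l =
  if (d %| l)%N then (-1) ^+ (l %/ d) * 'C(n, l %/ d)%:Z else 0.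
Proof.
move=> d0; have -> : (1 - 'X^d) ^+ n = ((1 - 'X) ^+ n) \Po 'X^d :> {poly int}.
  by rewrite rmorphXn /= comp_polyB comp_polyX comp_polyC.
by rewrite coef_comp_poly_Xn // coef_one_sub_X_exp.
Qed.

Lemma sum_multiples d i m (F : nat -> int) : (0 < d)%N -> (i * d <= m)%N ->
  (forall l, (l <= m)%N -> F l != 0 -> exists2 j, (j <= i)%N & l = (j * d)%N) ->
  \sum_(l < m.+1) F l = \sum_(j < i.+1) F (j * d)%N.
Proof.
move=> d0 idm F0.
transitivity (\sum_(l < m.+1) \sum_(j < i.+1) if (j * d == l)%N then F l else 0).
  apply: eq_bigr => l _; have [Fl|Fl] := eqVneq (F l) 0.
    by rewrite big1 // => j _; rewrite Fl if_same.
  have [j ji lj] := F0 l (ltn_ord l) Fl; have ji' : (j < i.+1)%N by [].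
  rewrite (bigD1 (Ordinal ji')) //= -lj eqxx big1 ?addr0 // => j' jj'.
  rewrite lj eqn_pmul2r // ifN //; by rewrite -(inj_eq val_inj) in jj'.
rewrite exchange_big; apply: eq_bigr => j _ /=.
have jm : (j * d < m.+1)%N by rewrite ltnS (leq_trans _ idm) // leq_pmul2r // -ltnS.
rewrite (bigD1 (Ordinal jm)) //= eqxx big1 ?addr0 // => l lj.
by rewrite ifN // eq_sym; rewrite -(inj_eq val_inj) in lj.
Qed.

Lemma coefP_veronese (K : fieldType) n d k i : (0 < d)%N ->
  coefP K n d k (k + i * d) =
  \sum_(j < i.+1) (-1) ^+ j * 'C(expN n d, j)%:Z * (expN n (d * (i - j) + k))%:Z.
Proof.
move=> d0; rewrite /coefP /coef_mul_series.
pose F l := ((1 - 'X^d) ^+ expN n d : {poly int})`_l *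
  (hilbert (veronese K n d k) (k + i * d - l))%:Z.
rewrite (@sum_multiples d i (k + i * d) F) ?leq_addl // => [|l lm Fl].
  apply: eq_bigr => j _; rewrite /F coef_one_sub_Xn_exp // dvdn_mull // mulnK //.
  have ji : (j <= i)%N by rewrite -ltnS.
  have -> : (k + i * d - j * d = d * (i - j) + k)%N.
    by rewrite -addnBA ?leq_pmul2r // -mulnBl mulnC addnC.
  by rewrite hilbert_veronese.
have /dvdnP[j lj] : (d %| l)%N.
  by apply: contraNT Fl => dl; rewrite /F coef_one_sub_Xn_exp // (negPf dl) mul0r.
(* For j > i the remaining degree is below k, where the module vanishes; natural subtraction may
   truncate to 0, still below k. *)
exists j => //; rewrite leqNgt; apply: contraNN Fl => ij.
rewrite /F hilbert_veronese_lt ?mulr0 // lj.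
have : (i.+1 * d <= j * d)%N by rewrite leq_pmul2r.
by move: lm; rewrite lj mulSn; lia.
Qed.

Lemma rank_tor_part (K : fieldType) N d (M : gradedModule K N d)
    (F : gradedFreeResolution M) i j e :
  (forall a : 'I_(rk F i), gdeg a = e) ->
  \rank (tor_part F i j) = if j == e then rk F i else 0%N.
Proof.
move=> Fe; have -> : tor_part F i j = if j == e then 1%:M else 0.
  apply/matrixP => a b; rewrite mxE mxE Fe eq_sym.
  by case: ifP => _; rewrite mxE ?mul0rn // mulr1n.
by case: ifP => _; rewrite ?mxrank1 ?mxrank0.
Qed.

Lemma total_betti_single (K : fieldType) N d (M : gradedModule K N d) i e :
  (forall j, j != e -> betti M i j = 0%N) -> total_betti M i = betti M i e.
Proof.
move=> b0; rewrite /total_betti -(fsbig_widen [set e] [set: nat]) ?fsbig_set1 //.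
by move=> j [_ /= /eqP]; exact: b0.
Qed.

Theorem corollary3p14 (K : fieldType) (n d k : nat)
    (n_ge1 : (1 <= n)%N) (d_ge1 : (1 <= d)%N) (k_neq0 : k <> 0%N) :
  [/\ total_betti (veronese K n d k) 0 = betti (veronese K n d k) 0 k,
      total_betti (veronese K n d k) 1 = betti (veronese K n d k) 1 (k + d)%N
    & forall i : nat, (i <= 2)%N ->
        (betti (veronese K n d k) i (k + i * d)%N)%:Z
          = (-1) ^+ i * coefP K n d k (k + i * d)%N].
Proof.
have k_gt0 : (0 < k)%N by rewrite lt0n; apply/eqP.
pose F := minimal_resolution d_ge1 (vgen_hom K d (k := k)) (@vgen_gen K n d k).
have minF : minimal F by apply: minimal_resolutionP; exact: vgen_min.
have deg0 (a : 'I_(rk F 0)) : gdeg a = k by [].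
pose D0 := diff F 0 : 'M_(rk F 1, expN n k).
have hom0 : hom_mx d (gdeg (g := F) (i :=
  1)) (fun=> k) D0 by exact: (@diff_hom _ _ _ _ F 0).
have exact0 : forall w, ev (vgen K d (k := k)) w = 0 <-> exists u, w = u *m D0 :=
  aug_exact (g := F).
have min0 : no_unit (fun u => u *m D0 = 0) := minF.2 0%N.
have deg1 : forall a : 'I_(rk F 1), gdeg a = (d * 1 + k)%N.
  exact: (gdeg1E d_ge1 k_gt0 hom0 exact0 min0).
have dim0 := strand_dim0 d_ge1 k_gt0 hom0 exact0 min0.
have dim1 := strand_dim1 d_ge1 k_gt0 hom0 (@diff_hom _ _ _ _ F 1) exact0
  (diff_exact (g := F) (i := 0)) min0 (minF.2 1%N).
have betti0 j : betti (veronese K n d k) 0 j = if j == k then expN n k else 0%N.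
  by rewrite (betti_minimal 0 j minF) (rank_tor_part j deg0).
have betti1 j : betti (veronese K n d k) 1 j = if j == (k + d)%N then rk F 1 else 0%N.
  by rewrite (betti_minimal 1 j minF) (rank_tor_part j deg1) muln1 addnC.
have betti2 : betti (veronese K n d k) 2 (k + 2 * d)%N = \rank (tor_part F 2 (k + 2 *
  d)%N).
  exact: betti_minimal.
(* Positivity of N is required for the binomial count of monomials in the y variables. *)
have N_gt0 : (0 < expN n d)%N by rewrite expN_bin // bin_gt0; lia.
set N := expN n d in N_gt0 dim0 dim1 *.
have binN1 : expN N 1 = N by rewrite expN_bin // add1n subn1 bin1.
have {}dim0 : (rk F 1 + expN n (d * 1 + k) = N * expN n k)%N.
  by move: dim0; rewrite binN1 expN_bin // bin0 mul1n.
have {}dim1 : (betti (veronese K n d k) 2 (k + 2 * d)%N + ('C(N, 2) + N) * expN n k =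
    N * rk F 1 + expN n (d * 2 + k))%N.
  move: dim1; rewrite binN1 (expN_bin 2 N_gt0) add2n subn1 binS bin1.
  by rewrite betti2 [(k + _)%N]addnC [(2 * _)%N]mulnC.
split.
- by apply: total_betti_single => j /negPf jk; rewrite betti0 jk.
- by apply: total_betti_single => j /negPf jk; rewrite betti1 jk.
have sgn2 : (-1) ^+ 2 = 1 :> int by rewrite sqrrN expr1n.
move=> i i2; rewrite coefP_veronese // -/N.
case: i i2 => [|[|[|//]]] _; rewrite !big_ord_recr big_ord0 /= ?sgn2
  ?(expr0, expr1, mul1r, mulN1r, bin0, bin1, subSS, subn0, subnn, muln0, add0n, add0r).
- by rewrite betti0 addn0 eqxx.
- by rewrite betti1 mul1n eqxx; lia.
(* Multiplying the degree k + d count by N produces N^2; this identity turns it into the C(N,2) of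
   P(z). *)
have binN2 : (N * N = 'C(N, 2) + 'C(N, 2) + N)%N.
  have := mul_bin_diag N 1; rewrite bin1; have := N_gt0; nia.
have dimN : (N * rk F 1 + N * expN n (d * 1 + k) = (N * N) * expN n k)%N.
  by rewrite -mulnDr dim0 mulnA.
rewrite binN2 in dimN.
move: dimN dim1; move: (betti _ _ _) (rk F 1) (expN n (d * 1 + k)) (expN n (d * 2 +
  k)) (expN n k) 'C(N, 2).
move=> b r h1 h2 h0 t dimN dim1.
(* The rank [r] of F_1 cancels between the two counts. *)
have : (b + N * h1 = t * h0 + h2)%N by nia.
lia.
Qed.
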